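(* Let $q$ be a power of a prime $p$, $K$ an algebraic closure of $\mathbb{F}_q$, with $\mathrm{PSL}(3,q)$ acting on $\mathrm{PG}(2,K)$. Then $d(\mathrm{PSL}(3,q))=q^3-q^2$, $\varepsilon(\mathrm{PSL}(3,q))=q^2-q$, and the DGZ curve is the only $\mathrm{PSL}(3,q)$-invariant irreducible plane curve of degree $q^3-q^2$.
   Context: Plane curves are over $K$; irreducible means irreducible over $K$; $G$-invariant means mapped onto itself by every element of $G$. $d(G)$ is the smallest degree of a $G$-invariant irreducible plane curve other than a line; $\varepsilon(G)=d'(G)-d(G)$ where $d'(G)$ is the smallest degree larger than $d(G)$ of a $G$-invariant irreducible plane curve. The DGZ curve has affine equation $\frac{(X^{q^3}-X)(Y^{q}-Y)-(Y^{q^3}-Y)(X^{q}-X)}{(X^{q^2}-X)(Y^q-Y)-(Y^{q^2}-Y)(X^q-X)}=0$ (exact polynomial quotient). *)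

(* Defs.v *)
From HB Require Import structures.
From mathcomp Require Import all_boot all_order all_algebra.
From mathcomp Require Import mpoly.
Set Implicit Arguments. Unset Strict Implicit. Unset Printing Implicit Defensive.
Import Order.TTheory GRing.Theory.
Local Open Scope ring_scope.

Section PlaneCurves.
Variable K : fieldType.

Definition inFq (q : nat) (x : K) : bool := x ^+ q == x.

Definition algebraic_over_Fq (q : nat) : Prop :=
  forall x : K, exists P : {poly K},
    [/\ P != 0, (forall i, inFq q P`_i) & root P x].

(* SL(3,q) as 3x3 matrices over F_q (inside K) of determinant 1.
   It acts on PG(2,K) via v |-> v *m M (row vectors); scalar matrices act
   trivially, so this is the action of PSL(3,q). *)
Definition inSL3q (q : nat) (M : 'M[K]_3) : bool :=
  [forall i, forall j, inFq q (M i j)] && (\det M == 1).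

Definition plane_curve (n : nat) (F : {mpoly K[3]}) : Prop :=
  F != 0 /\ F \is n.-homog.

Definition irreducible_mpoly (F : {mpoly K[3]}) : Prop :=
  (1 < msize F)%N /\
  forall G H : {mpoly K[3]}, F = G * H -> (msize G <= 1)%N \/ (msize H <= 1)%N.

Definition on_curve (F : {mpoly K[3]}) (v : 'rV[K]_3) : bool :=
  F.@[fun i => v 0 i] == 0.

Definition G_invariant (G : pred 'M[K]_3) (F : {mpoly K[3]}) : Prop :=
  forall M, G M -> forall v : 'rV[K]_3, on_curve F (v *m M) = on_curve F v.

Definition has_inv_irr_curve (G : pred 'M[K]_3) (n : nat) : Prop :=
  exists F, [/\ plane_curve n F, irreducible_mpoly F & G_invariant G F].

Definition is_dG (G : pred 'M[K]_3) (n : nat) : Prop :=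
  (2 <= n)%N /\ has_inv_irr_curve G n /\
  forall m, (2 <= m)%N -> has_inv_irr_curve G m -> (n <= m)%N.

(* e = epsilon(G) = d'(G) - d(G), where d'(G) is the least degree larger than
   d(G) of a G-invariant irreducible curve. *)
Definition is_epsG (G : pred 'M[K]_3) (e : nat) : Prop :=
  exists d, is_dG G d /\
  [/\ (0 < e)%N, has_inv_irr_curve G (d + e) &
      forall m, (d < m)%N -> has_inv_irr_curve G m -> (d + e <= m)%N].

Definition mX : {mpoly K[3]} := 'X_(@Ordinal 3 0 isT).
Definition mY : {mpoly K[3]} := 'X_(@Ordinal 3 1 isT).

Definition DGZ_num (q : nat) : {mpoly K[3]} :=
  (mX ^+ (q ^ 3) - mX) * (mY ^+ q - mY) - (mY ^+ (q ^ 3) - mY) * (mX ^+ q - mX).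
Definition DGZ_den (q : nat) : {mpoly K[3]} :=
  (mX ^+ (q ^ 2) - mX) * (mY ^+ q - mY) - (mY ^+ (q ^ 2) - mY) * (mX ^+ q - mX).

Definition dehom (F : {mpoly K[3]}) : {mpoly K[3]} :=
  F \mPo [tuple mX; mY; 1].

(* F (a plane curve of degree q^3-q^2) is the DGZ curve: its affine part
   F(X,Y,1) is a nonzero multiple of the exact quotient DGZ_num / DGZ_den. *)
Definition is_DGZ_curve (q : nat) (F : {mpoly K[3]}) : Prop :=
  exists c : K, c != 0 /\ dehom F * DGZ_den q = c *: DGZ_num q.

End PlaneCurves.

(* Main.v *)
Require Import Defs.
From HB Require Import structures.
From mathcomp Require Import all_boot all_order all_algebra all_field.
From mathcomp Require Import mpoly.
From mathcomp Require Import zify ring.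
From Stdlib Require Import Classical.
Set Implicit Arguments. Unset Strict Implicit. Unset Printing Implicit Defensive.
Import Order.TTheory GRing.Theory.
Local Open Scope ring_scope.

(** An irreducible form whose zero set is SL(3,q)-invariant is semi-invariant by the
    Nullstellensatz, hence fixed by every transvection, since transvections have
    order p in characteristic p. If z does not divide an invariant form F of degree
    n > 0, then the elations with axis z = 0 force f(x) = F(x, 1, 0) to lie in
    K[x^q], and GL(2,q)-invariance of f gives q^2 (q - 1) | n when F(0, 1, 0) <> 0,
    and n >= q^3 - q otherwise, since f then vanishes to order at least q (q - 1)
    at all q + 1 points over F_q. In degree q^3 - q^2 an invariant form vanishing
    at (0 : 1 : 0) would vanish to order at least q on all F_q-lines, hence is 0;
    so the Dickson invariant of that degree is the only one up to scalars.

    Both Dickson invariants (of degrees q^3 - q^2 and q^3 - q) are irreducible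
    because every irreducible factor is itself invariant: a transvection moving a
    factor A would make the product of A and its image divide the invariant. For
    degree q^3 - q this contradicts the separability of the tangent cone at an
    F_q-point; for degree q^3 - q^2 the curve meets z = 0 only at points
    (t : 1 : 0) with t in F_{q^2} but not in F_q, where it is unibranch with Newton
    polygon from (q, 0) to (0, q - 1). Complementary invariant factors then have
    degree at least q^3 - q^2 each, which is too large. *)

(** * Unique factorization and the Nullstellensatz for hypersurfaces *)

Section Divisibility.
Variable R : idomainType.
Implicit Types a b c : R.

(** The divisor q^2 (q - 1) of n arises from three constraints on f. If f = g(x^q), translations by
    F_q make g a polynomial in x^q - x, so q^2 divides deg f; diagonal scalings make every exponent
    a multiple of q - 1; and f(0) <> 0 forces deg f = n, by the swap of the two coordinates.

    The two Dickson curves need different irreducibility arguments because they behave oppositely at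
    F_q-points. The curve of degree q^3 - q passes through them and so has a tangent cone there,
    which is preserved by the transvections with that centre. The other curve avoids all F_q-points;
    there one uses the transvections with axis z = 0, which fix that line pointwise, so that a
    factor and its image would meet the line at a common point. In both cases only one family of
    transvections is treated, and a cyclic permutation of the coordinates supplies the others. Two
    invariant factors are impossible in degree q^3 - q because 2 (q^3 - q^2) - (q^3 - q) = q (q -
    1)^2 > 0. *)

Definition rdvd a b := exists c, b = c * a.

Definition irreducible_elt a :=
  [/\ a != 0, a \isn't a GRing.unit &
      forall b c, a = b * c -> b \is a GRing.unit \/ c \is a GRing.unit].

(** Euclid's lemma for [a]: the divisibility half of primality. *)
Definition euclidean_elt a := forall b c, rdvd a (b * c) -> rdvd a b \/ rdvd a c.

Lemma rdvd_mull a b c : rdvd a b -> rdvd a (c * b).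
Proof. by case=> d ->; exists (c * d); rewrite mulrA. Qed.

Lemma rdvd_mulr a b c : rdvd a b -> rdvd a (b * c).
Proof. by rewrite mulrC; apply: rdvd_mull. Qed.

Lemma rdvdD a b c : rdvd a b -> rdvd a c -> rdvd a (b + c).
Proof. by case=> d -> [e ->]; exists (d + e); rewrite mulrDl. Qed.

Lemma rdvdB a b c : rdvd a b -> rdvd a c -> rdvd a (b - c).
Proof. by case=> d -> [e ->]; exists (d - e); rewrite mulrBl. Qed.

End Divisibility.

Lemma polyC_unit (R : idomainType) (c : R) :
  (c%:P \is a GRing.unit) = (c \is a GRing.unit).
Proof.
rewrite poly_unitE coefC /= size_polyC; case: (eqVneq c 0) => // ->.
by rewrite unitr0.
Qed.

Lemma irreducible_of_polyC (R : idomainType) (c : R) :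
  irreducible_elt c%:P -> irreducible_elt c.
Proof.
case=> c0 nu H; split=> [||b d e]; first by rewrite -polyC_eq0.
  by rewrite -polyC_unit.
by rewrite -(polyC_unit b) -(polyC_unit d); apply: H; rewrite e polyCM.
Qed.

Lemma map_poly_common_root (R S : idomainType) (phi : {rmorphism R -> S})
    (u f w g : {poly R}) (e : R) (z : S) :
  u * f + w * g = e%:P -> root (map_poly phi f) z -> root (map_poly phi g) z ->
  phi e = 0.
Proof.
move=> eq /rootP fz /rootP gz.
have := congr1 (fun q => (map_poly phi q).[z]) eq.
by rewrite rmorphD !rmorphM map_polyC !hornerE fz gz !mulr0 addr0.
Qed.

(** * Gauss's lemma: primality of irreducibles passes from R to R[X] *)

Section Gauss.
Variables (R : idomainType) (N : R -> nat).
Hypothesis NM : forall a b : R, a != 0 -> b != 0 -> N (a * b) = (N a + N b)%N.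
Hypothesis N0_unit : forall a : R, a != 0 -> N a = 0%N -> a \is a GRing.unit.
Hypothesis R_euclid : forall a : R, irreducible_elt a -> euclidean_elt a.

(** [N] stands for a degree: additive on products and positive on nonzero nonunits, it makes the
    descent to proper factors terminate. *)
Lemma irreducible_factor (a : R) : a != 0 -> a \isn't a GRing.unit ->
  exists b, irreducible_elt b /\ rdvd b a.
Proof.
have [n] := ubnP (N a); elim: n a => // n IHn a leNa a0 nua.
have [irra|nirra] := classic (irreducible_elt a).
  by exists a; split=> //; exists 1; rewrite mul1r.
have [b [c [e nub nuc]]] : exists b c,
    [/\ a = b * c, b \isn't a GRing.unit & c \isn't a GRing.unit].
  apply: NNPP => H; case: nirra; split=> // b c e.
  case ub: (b \is a GRing.unit); first by left.
  case uc: (c \is a GRing.unit); first by right.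
  by case: H; exists b, c; rewrite ub uc.
have /andP[b0 c0] : (b != 0) && (c != 0) by rewrite -negb_or -mulf_eq0 -e.
have Nc : (0 < N c)%N.
  by rewrite lt0n; apply: contra nuc => /eqP /(N0_unit c0).
have [|d [irrd [f ef]]] := IHn b _ b0 nub.
  by move: leNa; rewrite e NM //; lia.
by exists d; split=> //; rewrite e ef mulrC; exists (c * f); rewrite mulrA.
Qed.

Lemma rdvd_polyC (a : R) (f : {poly R}) :
  rdvd a%:P f <-> forall i, rdvd a f`_i.
Proof.
split=> [[g ->] i|H]; first by rewrite coefMC; exists g`_i.
(* The quotients are only known to exist one by one; induction on [f] gathers them into a
   function. *)
have [g Hg] : exists g : nat -> R, forall i, f`_i = g i * a.
  elim/poly_ind: f H => [|f c IHf] H.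
    by exists (fun=> 0) => i; rewrite coef0 mul0r.
  have [i|g Hg] := IHf; first by have := H i.+1; rewrite coefD coefMX coefC addr0.
  have := H 0%N; rewrite coefD coefMX coefC add0r => -[d Hd].
  exists (fun i => if i is j.+1 then g j else d) => -[|i].
    by rewrite coefD coefMX coefC add0r.
  by rewrite coefD coefMX coefC /= addr0.
exists (\poly_(i < size f) g i); apply/polyP => i; rewrite coefMC coef_poly.
by case: ltnP => [//|le]; rewrite mul0r nth_default.
Qed.

(** If [a] divides f g, it divides the product of the constant terms, hence one of them, say that of
    f. Subtracting that term and dividing by X replaces f by a shorter polynomial. *)
Lemma euclidean_polyC (a : R) : irreducible_elt a -> euclidean_elt (a%:P).
Proof.
move=> irra; have Pa := R_euclid irra.
suff main n (f g : {poly R}) : (size f + size g < n)%N ->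
    rdvd a%:P (f * g) -> rdvd a%:P f \/ rdvd a%:P g.
  by move=> f g; apply: (main (size f + size g).+1).
elim: n f g => // n IHn f g len H.
have dec (h : {poly R}) : h != 0 -> exists h1 c,
   h = h1 * 'X + c%:P /\ (size h1 < size h)%N.
  elim/poly_ind: h => [|h1 c _]; first by rewrite eqxx.
  move=> h0; exists h1, c; split=> //; rewrite size_MXaddC.
  by case: ifP => // /andP[/eqP h10 /eqP c0]; move: h0; rewrite h10 c0 mul0r add0r eqxx.
have shift (h : {poly R}) : rdvd a%:P (h * 'X) -> rdvd a%:P h.
  by move/rdvd_polyC=> Hh; apply/rdvd_polyC => i; have := Hh i.+1; rewrite coefMX.
have consdvd (h : {poly R}) c : rdvd a c -> rdvd a%:P h -> rdvd a%:P (h * 'X + c%:P).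
  move=> [d ->] Hh; apply: rdvdD; first exact: rdvd_mulr.
  by exists d%:P; rewrite polyCM.
have [->|f0] := eqVneq f 0; first by left; exists 0; rewrite mul0r.
have [->|g0] := eqVneq g 0; first by right; exists 0; rewrite mul0r.
have [f1 [c [ef sf]]] := dec f f0; have [g1 [d [eg sg]]] := dec g g0.
have /rdvd_polyC/(_ 0%N) := H.
rewrite {1}ef {1}eg -horner_coef0 hornerM !hornerMXaddC !mulr0 !add0r => /Pa [dc|dd].
- have : rdvd a%:P (f1 * g).
    apply: shift; rewrite mulrAC.
    have -> : f1 * 'X * g = f * g - c%:P * g by rewrite {1}ef; ring.
    apply: rdvdB => //; apply: rdvd_mulr; case: dc => e ->.
    by exists e%:P; rewrite polyCM.
  case/IHn=> [|H1|H1]; first by lia.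
    by left; rewrite ef; apply: consdvd.
  by right.
- have : rdvd a%:P (f * g1).
    apply: shift; rewrite -mulrA.
    have -> : f * (g1 * 'X) = f * g - f * d%:P by rewrite {1}eg; ring.
    apply: rdvdB => //; apply: rdvd_mull; case: dd => e ->.
    by exists e%:P; rewrite polyCM.
  case/IHn=> [|H1|H1]; first by lia.
    by left.
  by right; rewrite eg; apply: consdvd.
Qed.

(** Each irreducible factor of [c] stays prime in R[X], so it divides [m] or [s]; it is cancelled
    there and recorded in [a] or [b], and [N c] drops. *)
Lemma gauss_split (c : R) (f m s : {poly R}) : c != 0 -> m * s = c%:P * f ->
  exists m' s' a b, [/\ m' * s' = f, m = a%:P * m' & s = b%:P * s'].
Proof.
have [n] := ubnP (N c); elim: n c m s => // n IHn c m s leNc c0 e.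
case uc : (c \is a GRing.unit).
  exists m, ((c^-1)%:P * s), 1, c; rewrite mul1r; split=> //.
    by rewrite mulrCA e mulrA -polyCM mulVr // mul1r.
  by rewrite mulrA -polyCM divrr // mul1r.
have [p [irrp [d ed]]] := irreducible_factor c0 (negbT uc).
have p0 : p != 0 by case: irrp.
have d0 : d != 0 by apply: contraNneq c0 => d0; rewrite ed d0 mul0r.
have Np : (0 < N p)%N.
  by rewrite lt0n; case: irrp => _ nup _; apply: contra nup => /eqP/(N0_unit p0).
have ltNd : (N d < n)%N by move: leNc; rewrite ed NM //; lia.
have pP0 : p%:P != 0 by rewrite polyC_eq0.
have : rdvd p%:P (m * s) by rewrite e ed polyCM; exists (d%:P * f); ring.
case/(euclidean_polyC irrp)=> -[g eg].
- have [|m' [s' [a [b [e1 e2 e3]]]]] := IHn d g s ltNd d0.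
    by apply: (mulfI pP0); rewrite mulrA [p%:P * g]mulrC -eg e ed polyCM; ring.
  by exists m', s', (p * a), b; split=> //; rewrite eg e2 polyCM; ring.
- have [|m' [s' [a [b [e1 e2 e3]]]]] := IHn d m g ltNd d0.
    apply: (mulfI pP0); rewrite mulrCA [p%:P * g]mulrC -eg e ed polyCM; ring.
  by exists m', s', a, (p * b); split=> //; rewrite eg e3 polyCM; ring.
Qed.

(** A nonconstant irreducible polynomial has only unit constant factors, so none of [c] can be
    absorbed by [f]. *)
Lemma irreducible_poly_cancel (c : R) (f g w : {poly R}) :
  irreducible_elt f -> (1 < size f)%N -> c != 0 -> c%:P * g = w * f -> rdvd f g.
Proof.
move=> irrf sf c0 e.
have [w' [f' [a [b [e1 e2 e3]]]]] := gauss_split c0 (esym e).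
have [f0 _ /(_ _ _ e3)] := irrf; case=> [ub|uf'].
  exists (w' * (b^-1)%:P); rewrite -e1 e3 -mulrA.
  by rewrite [_ * (_ * f')]mulrA -polyCM mulVr ?mul1r // -polyC_unit.
exfalso; move: sf; rewrite e3 size_Cmul.
  by have /eqP -> : size f' == 1%N by move: uf'; rewrite poly_unitE => /andP[].
by apply: contraNneq f0 => b0; rewrite e3 b0 mul0r.
Qed.

(* Over the fraction field, [f] either divides [g] or is coprime to it; Gauss'
   lemma and a Bezout relation with denominators cleared bring this down to [R]. *)
Lemma irreducible_poly_dvd_or_bezout (f g : {poly R}) :
  irreducible_elt f -> (1 < size f)%N ->
  rdvd f g \/ exists u v e, e != 0 /\ u * f + v * g = e%:P.
Proof.
move=> irrf sf; have [f0 nuf _] := irrf.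
pose d := gcdp f g.
have /Pdiv.Idomain.dvdpP[[c s] /= c0 e] : d %| f := dvdp_gcdl f g.
rewrite -mul_polyC in e.
have [s' [d' [a [b [e1 e2 e3]]]]] := gauss_split c0 (esym e).
have d0 : d != 0 by rewrite gcdp_eq0 negb_and f0.
have b0 : b != 0 by apply: contraNneq d0 => b0; rewrite e3 b0 mul0r.
case: irrf => _ _ irr; case: (irr _ _ (esym e1)) => [us|ud].
- have /Pdiv.Idomain.dvdpP[[c' t] /= c'0 e'] : d %| g := dvdp_gcdr f g.
  left; apply: (@irreducible_poly_cancel c' _ _ (t * b%:P * s'^-1)) => //.
  by rewrite mul_polyC e' e3 -e1 mulrA -!mulrA mulKr.
- right; have [[u v] /= /eqpP[[k1 k2] /= /andP[k10 k20] ek]] := Bezoutp f g.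
  have sd : size d' == 1%N by move: ud; rewrite poly_unitE => /andP[].
  have /size_poly1P [k k0 ek'] := sd.
  exists (k1%:P * u), (k1%:P * v), (k2 * (b * k)); split; first by rewrite !mulf_neq0.
  rewrite -!mulrA -mulrDr mul_polyC ek -/d e3 ek' -mul_polyC.
  by rewrite !polyCM.
Qed.

(** If [f] does not divide [g], multiplying the Bezout relation u f + v g = k by [h] shows that [f]
    divides k h, and the constant k cancels. *)
Lemma euclidean_poly (f : {poly R}) : irreducible_elt f -> euclidean_elt f.
Proof.
move=> irrf; case: (ltnP 1 (size f)) => sf.
- move=> g h [w e].
  case: (irreducible_poly_dvd_or_bezout g irrf sf) => [|[u [v [k [k0 ek]]]]]; first by left.
  right; apply: (@irreducible_poly_cancel k _ _ (u * h + v * w)) => //.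
  by rewrite -ek mulrDl -!mulrA e; ring.
- have [a ea] : exists a, f = a%:P by exists f`_0; rewrite -size1_polyC.
  by rewrite ea; apply/euclidean_polyC/irreducible_of_polyC; rewrite -ea.
Qed.

End Gauss.

(** * Multivariate polynomials as univariate ones in the last variable *)

Section MuniIso.
Variables (K : idomainType) (n : nat).

Definition muni_inv (f : {poly {mpoly K[n]}}) : {mpoly K[n.+1]} :=
  (map_poly (@mwiden n K) f).['X_ord_max].

Lemma muni_invM : {morph muni_inv : f g / f * g}.
Proof. by move=> f g; rewrite /muni_inv rmorphM hornerM. Qed.

Lemma muni_invD : {morph muni_inv : f g / f + g}.
Proof. by move=> f g; rewrite /muni_inv rmorphD hornerD. Qed.

Lemma muni_inv0 : muni_inv 0 = 0.
Proof. by rewrite /muni_inv rmorph0 horner0. Qed.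

Lemma muni_inv1 : muni_inv 1 = 1.
Proof. by rewrite /muni_inv rmorph1 hornerC. Qed.

Lemma muni_invC c : muni_inv c%:P = mwiden c.
Proof. by rewrite /muni_inv map_polyC hornerC. Qed.

Lemma muni_invX : muni_inv 'X = 'X_ord_max.
Proof. by rewrite /muni_inv map_polyX hornerX. Qed.

Lemma muniK : cancel (@muni n K) muni_inv.
Proof.
move=> p; rewrite muniE (big_morph _ muni_invD muni_inv0) [RHS]mpolyE.
apply: eq_bigr => m _; rewrite -mul_polyC muni_invM muni_invC mwidenZ -scalerAl.
congr (_ *: _); rewrite mwidenX.
have -> : muni_inv 'X^(m ord_max) = 'X_ord_max ^+ m ord_max.
  by rewrite /muni_inv map_polyXn hornerXn.
rewrite mpolyXn -mpolyXD; congr 'X_[_]; apply/mnmP => i.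
rewrite mnmDE mulmnE mnm1E.
have [/eqP <-|ne] := boolP (ord_max == i).
  by rewrite mnmwiden_ordmax mul1n.
have li : (i < n)%N.
  by rewrite ltn_neqAle -ltnS ltn_ord andbT; apply: contra ne => /eqP e; apply/eqP/val_inj.
have -> : i = widen_ord (leqnSn n) (Ordinal li) by apply: val_inj.
by rewrite mnmwiden_widen mnmE mul0n addn0.
Qed.

Lemma muniX_last : muni ('X_ord_max : {mpoly K[n.+1]}) = 'X.
Proof.
rewrite muniE msuppX big_seq1 mcoeffX eqxx scale1r mnm1E eqxx expr1.
have -> : [multinom U_(ord_max : 'I_n.+1)%MM (widen_ord (leqnSn n) i) | i < n] = 0%MM.
  apply/mnmP => i; rewrite mnmE mnm1E mnm0E -val_eqE /=.
  by rewrite gtn_eqF.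
by rewrite mpolyX0 scale1r.
Qed.

Lemma muni_mwiden (c : {mpoly K[n]}) : muni (mwiden c) = c%:P.
Proof.
elim/mpolyind: c => [|k m c _ _ IH]; first by rewrite mwiden0 muni0.
rewrite mwidenD muniD IH polyCD mwidenZ muniZ -mul_mpolyC polyCM mul_polyC.
congr (_ *: _ + _).
rewrite mwidenX muniE msuppX big_seq1 mcoeffX eqxx scale1r mnmwiden_ordmax expr0.
rewrite -mul_polyC mulr1; congr ('X_[_])%:P.
by apply/mnmP => i; rewrite mnmE mnmwiden_widen.
Qed.

Lemma muni_invK : cancel muni_inv (@muni n K).
Proof.
move=> f; elim/poly_ind: f => [|f c IH]; first by rewrite muni_inv0 muni0.
by rewrite muni_invD muni_invM muniD muniM IH muni_invX muniX_last muni_invC muni_mwiden.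
Qed.

Lemma muni_unit (p : {mpoly K[n.+1]}) : (muni p \is a GRing.unit) = (p \is a GRing.unit).
Proof.
apply/idP/idP => /unitrP[q [e _]]; apply/unitrP.
  have H : muni_inv q * p = 1 by rewrite -{1}[p]muniK -muni_invM e muni_inv1.
  by exists (muni_inv q); split; [exact: H | rewrite mulrC; exact: H].
have H : muni q * muni p = 1 by rewrite -muniM e muni1.
by exists (muni q); split; [exact: H | rewrite mulrC; exact: H].
Qed.

Lemma muni_irreducible (p : {mpoly K[n.+1]}) : irreducible_elt p -> irreducible_elt (muni p).
Proof.
case=> p0 nu H; split=> [||b c e]; last 1 first.
- have ub d : (muni_inv d \is a GRing.unit) = (d \is a GRing.unit).
    by have := muni_unit (muni_inv d); rewrite muni_invK => ->.
  have E : p = muni_inv b * muni_inv c by rewrite -muni_invM -e muniK.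
  by have := H _ _ E; rewrite !ub.
- by apply: contraNneq p0 => e; rewrite -[p]muniK e muni_inv0.
- by rewrite muni_unit.
Qed.

Lemma muni_rdvd (p q : {mpoly K[n.+1]}) : rdvd (muni p) (muni q) -> rdvd p q.
Proof. by case=> c e; exists (muni_inv c); rewrite -[q]muniK e muni_invM muniK. Qed.

End MuniIso.

Section MpolyFactor.
Variable K : fieldType.

Lemma mpoly_unitE n (p : {mpoly K[n]}) : (p \is a GRing.unit) = (msize p == 1%N).
Proof.
apply/andP/msize_poly1P => /= [[/eqP e u]|[c c0 ->]].
  by exists p@_0; rewrite // -unitfE.
by rewrite mcoeffC eqxx mulr1 unitfE.
Qed.

Lemma mpoly_degM n (p q : {mpoly K[n]}) : p != 0 -> q != 0 ->
  (msize (p * q)).-1 = ((msize p).-1 + (msize q).-1)%N.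
Proof.
move=> p0 q0; rewrite msizeM //.
by rewrite (mpolySpred _ p0) (mpolySpred _ q0) /= addnS.
Qed.

Lemma mpoly_deg0_unit n (p : {mpoly K[n]}) : p != 0 -> (msize p).-1 = 0%N ->
  p \is a GRing.unit.
Proof. by move=> p0; rewrite mpoly_unitE (mpolySpred _ p0) /= => ->. Qed.

Lemma euclidean_mpoly n (p : {mpoly K[n]}) : irreducible_elt p -> euclidean_elt p.
Proof.
elim: n p => [|n IHn] p irrp.
  case: irrp => p0 /negP[].
  have [c e] : exists c, p = c%:MP by exists p@_0; apply: nvar0_mpolyC.
  by rewrite mpoly_unitE e msizeC; move: p0; rewrite e mpolyC_eq0 => ->.
move=> b c [d e].
have [|H|H] := euclidean_poly (@mpoly_degM n) (@mpoly_deg0_unit n) IHn (muni_irreducible irrp) (b := muni b) (c := muni c).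
- by rewrite -muniM e muniM; exists (muni d).
- by left; apply: muni_rdvd.
- by right; apply: muni_rdvd.
Qed.

End MpolyFactor.

(** * Zeros over an algebraically closed field *)

Section Evaluation.
Variable K : closedFieldType.

Lemma poly_eq0_of_roots (p : {poly K}) : (forall x, p.[x] = 0) -> p = 0.
Proof.
move=> H; apply/eqP/negPn/negP => /closed_nonrootP[x].
by rewrite /root H eqxx.
Qed.

Lemma mwiden_meval n (c : {mpoly K[n]}) (v : 'I_n.+1 -> K) :
  (mwiden c).@[v] = c.@[fun i => v (widen_ord (leqnSn n) i)].
Proof.
elim/mpolyind: c => [|k m c _ _ IH]; first by rewrite mwiden0 !meval0.
rewrite mwidenD !mevalD IH mwidenZ !mevalZ mwidenX !mevalX; congr (_ * _ + _).
rewrite big_ord_recr /= mnmwiden_ordmax expr0 mulr1.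
by apply: eq_bigr => i _; rewrite mnmwiden_widen.
Qed.

Definition extend_last n (v : 'I_n -> K) (z : K) (i : 'I_n.+1) : K :=
  if unlift ord_max i is Some j then v j else z.

Lemma meval_extend n (F : {mpoly K[n.+1]}) v z :
  F.@[extend_last v z] = (map_poly (meval v) (muni F)).[z].
Proof.
rewrite -{1}[F]muniK; move: (muni F) => f.
elim/poly_ind: f => [|f c IH]; first by rewrite muni_inv0 map_poly0 horner0 meval0.
rewrite muni_invD muni_invM muni_invX muni_invC mevalD mevalM IH.
rewrite rmorphD rmorphM /= map_polyX map_polyC hornerMXaddC; congr (_ * _ + _).
  by rewrite mevalXU /extend_last unlift_none.
rewrite mwiden_meval; apply: meval_eq => i; rewrite /extend_last.
have -> : widen_ord (leqnSn n) i = lift ord_max i.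
  by apply: val_inj; rewrite /= /bump leqNgt ltn_ord.
by rewrite liftK.
Qed.

Lemma mpoly_eq0_of_meval n (F : {mpoly K[n]}) : (forall v, F.@[v] = 0) -> F = 0.
Proof.
elim: n F => [|n IHn] F H.
  have [c e] : exists c, F = c%:MP by exists F@_0; apply: nvar0_mpolyC.
  by have := H (fun=> 0); rewrite e mevalC => ->; rewrite mpolyC0.
rewrite -[F]muniK; suff -> : muni F = 0 by rewrite muni_inv0.
apply/polyP => i; rewrite coef0; apply: IHn => v.
have : map_poly (meval v) (muni F) = 0.
  by apply: poly_eq0_of_roots => z; rewrite -meval_extend.
by move/polyP/(_ i); rewrite coef_map coef0.
Qed.

Lemma mpoly_eq_of_meval n (F G : {mpoly K[n]}) : (forall v, F.@[v] = G.@[v]) -> F = G.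
Proof.
move=> H; apply/eqP; rewrite -subr_eq0; apply/eqP; apply: mpoly_eq0_of_meval => v.
by rewrite mevalB H subrr.
Qed.

Lemma mpoly_neq0_meval n (F : {mpoly K[n]}) : F != 0 -> exists v, F.@[v] != 0.
Proof.
move=> F0; apply: NNPP => H; move/negP: F0; apply; apply/eqP.
apply: mpoly_eq0_of_meval => v; apply/eqP/negPn/negP => Hv; apply: H; by exists v.
Qed.

(** Induction on the number of variables. If [F] involves the last one, either it divides [H] or a
    Bezout relation produces a nonzero [e] free of that variable and vanishing wherever [F] has a
    zero above. Otherwise every coefficient of [H] vanishes on the zeros of [F]. *)
Lemma irreducible_rdvd_of_zeros n (F H : {mpoly K[n]}) : irreducible_elt F ->
  (forall v, F.@[v] = 0 -> H.@[v] = 0) -> rdvd F H.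
Proof.
elim: n F H => [|n IHn] F H irrF Hz.
  have [F0 /negP[]] := irrF.
  have [c e] : exists c, F = c%:MP by exists F@_0; apply: nvar0_mpolyC.
  by rewrite mpoly_unitE e msizeC; move: F0; rewrite e mpolyC_eq0 => ->.
apply: muni_rdvd; have irrf := muni_irreducible irrF.
have Hz' v z : (map_poly (meval v) (muni F)).[z] = 0 ->
    (map_poly (meval v) (muni H)).[z] = 0.
  by move=> E; have := Hz (extend_last v z); rewrite (meval_extend F) (meval_extend H); apply.
case: (ltnP 1 (size (muni F))) => sF; last first.
  have eF := size1_polyC sF; rewrite eF; apply/rdvd_polyC => i.
  apply: IHn => [|v cv].
    by apply: irreducible_of_polyC; rewrite -eF.
  have : map_poly (meval v) (muni H) = 0.
    apply: poly_eq0_of_roots => z; apply: Hz'.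
    by rewrite eF map_polyC hornerC /= cv.
  by move/polyP/(_ i); rewrite coef_map coef0.
have [//|[u [w [e [e0 eq]]]]] := irreducible_poly_dvd_or_bezout (@mpoly_degM K n)
   (@mpoly_deg0_unit K n) (@euclidean_mpoly K n) (muni H) irrf sF.
exfalso; have lF0 : lead_coef (muni F) != 0.
  by rewrite lead_coef_eq0; case: irrf.
(* With the leading coefficient nonzero at [v], the specialised [F] keeps its degree and so has a
   root. *)
have [v] := mpoly_neq0_meval (mulf_neq0 e0 lF0).
rewrite mevalM mulf_eq0 negb_or => /andP[ev lv].
have /closed_rootP[z rz] : size (map_poly (meval v) (muni F)) != 1%N.
  by rewrite size_map_poly_id0 // neq_ltn sF orbT.
have rH : root (map_poly (meval v) (muni H)) z by apply/rootP/Hz'/rootP.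
by move/eqP: ev; apply; apply: (map_poly_common_root eq rz rH).
Qed.

End Evaluation.

(** * Evaluation and the action of matrices on forms *)

Local Notation i0 := (@Ordinal 3 0 isT).
Local Notation i1 := (@Ordinal 3 1 isT).
Local Notation i2 := (@Ordinal 3 2 isT).

Section Evaluation3.
Variable K : fieldType.
Implicit Types F G : {mpoly K[3]}.

Definition coords (R : nzRingType) (x y z : R) (i : 'I_3) : R := nth 0 [:: x; y; z] i.

(** The point has coordinates in any ring over K, so that restriction to a line, translation and
    expansion along a branch are all evaluations, compared through [ev_morph]. *)
Definition ev (R : comNzRingType) (f : {rmorphism K -> R}) (x y z : R) F : R :=
  mmap f (coords x y z) F.

HB.instance Definition _ (R : comNzRingType) (f : {rmorphism K -> R}) (x y z : R) :=
  GRing.RMorphism.copy (ev f x y z) (mmap f (coords x y z)).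

Definition ev0 (x y z : K) F : K := ev idfun x y z F.

HB.instance Definition _ (x y z : K) := GRing.RMorphism.copy (ev0 x y z) (ev idfun x y z).

Lemma ev_morph (R S : comNzRingType) (f : {rmorphism K -> R}) (g : {rmorphism K -> S})
    (phi : {rmorphism R -> S}) x y z F :
  (forall c, phi (f c) = g c) ->
  phi (ev f x y z F) = ev g (phi x) (phi y) (phi z) F.
Proof.
move=> fg; rewrite /ev /mmap rmorph_sum; apply: eq_bigr => m _.
rewrite rmorphM fg /mmap1 rmorph_prod; congr (_ * _); apply: eq_bigr => i _.
by rewrite rmorphXn; congr (_ ^+ _); case: i => -[|[|[|]]].
Qed.

Lemma evZ (R : comNzRingType) (f : {rmorphism K -> R}) x y z c F :
  ev f x y z (c *: F) = f c * ev f x y z F.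
Proof. exact: mmapZ. Qed.

Lemma evX (R : comNzRingType) (f : {rmorphism K -> R}) x y z i :
  ev f x y z 'X_i = coords x y z i.
Proof. by rewrite /ev mmapX mmap1U. Qed.

Lemma ev0E x y z F : ev0 x y z F = F.@[coords x y z].
Proof. by []. Qed.

Lemma ev0_coords (v : 'I_3 -> K) F :
  ev0 (v i0) (v i1) (v i2) F = F.@[v].
Proof.
rewrite ev0E; apply: meval_eq => -[[|[|[|]]] //= lt]; congr (v _); exact: val_inj.
Qed.

Lemma ev_comp (R : comNzRingType) (f : {rmorphism K -> R}) x y z F
    (lq : 3.-tuple {mpoly K[3]}) :
  ev f x y z (F \mPo lq) = ev f (ev f x y z lq`_0) (ev f x y z lq`_1) (ev f x y z lq`_2) F.
Proof.
rewrite comp_mpolyEX [in RHS](mpolyE F) !rmorph_sum; apply: eq_bigr => m _ /=.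
rewrite !evZ; congr (_ * _); rewrite comp_mpolyX rmorph_prod /=.
rewrite [RHS]mmapX /mmap1; apply: eq_bigr => i _; rewrite rmorphXn /= (tnth_nth 0).
by congr (_ ^+ _); case: i => -[|[|[|]]].
Qed.

Lemma ev_homog (R : comNzRingType) (f : {rmorphism K -> R}) x y z c n F :
  F \is n.-homog -> ev f (c * x) (c * y) (c * z) F = c ^+ n * ev f x y z F.
Proof.
move=> hF; rewrite /ev /mmap big_distrr /= big_seq_cond [RHS]big_seq_cond.
apply: eq_bigr => m; rewrite andbT => /(dhomog_mf hF) dm.
have {}dm : mdeg m = n := dm.
rewrite mulrCA; congr (_ * _); rewrite /mmap1 -dm mdegE -prodrXr -big_split /=.
by apply: eq_bigr => i _; rewrite -exprMn; congr (_ ^+ _); case: i => -[|[|[|]]].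
Qed.

(** Each variable is replaced by a column of [M], so that [act M F] at v is F at [v *m M]. *)
Definition act (M : 'M[K]_3) F : {mpoly K[3]} :=
  F \mPo [tuple \sum_j M j i *: 'X_j | i < 3].

HB.instance Definition _ (M : 'M[K]_3) := GRing.RMorphism.copy (act M)
  (comp_mpoly [tuple \sum_j M j i *: 'X_j | i < 3]).

Lemma actZ M c F : act M (c *: F) = c *: act M F.
Proof. exact: comp_mpolyZ. Qed.

Lemma ev_act (R : comNzRingType) (f : {rmorphism K -> R}) x y z (M : 'M[K]_3) F :
  let L i := f (M i0 i) * x + f (M i1 i) * y + f (M i2 i) * z in
  ev f x y z (act M F) = ev f (L i0) (L i1) (L i2) F.
Proof.
move=> L; rewrite /act ev_comp -(tnth_nth 0 _ i0) -(tnth_nth 0 _ i1) -(tnth_nth 0 _ i2).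
rewrite !tnth_mktuple !rmorph_sum.
have E i : \sum_(j < 3) ev f x y z (M j i *: 'X_j) = L i.
  rewrite !big_ord_recl big_ord0 addr0 !evZ !evX /coords /= addrA /L.
  by congr (f (M _ _) * _ + f (M _ _) * _ + f (M _ _) * _); apply: val_inj.
by rewrite !E.
Qed.

Lemma meval_act M F (v : 'rV[K]_3) :
  (act M F).@[fun i => v 0 i] = F.@[fun i => (v *m M) 0 i].
Proof.
rewrite /act comp_mpoly_meval; apply: meval_eq => i.
rewrite tnth_mktuple raddf_sum mxE; apply: eq_bigr => j _ /=.
by rewrite mevalZ mevalXU mulrC.
Qed.

End Evaluation3.

(** * Translation-invariant polynomials *)

Section TranslationInvariant.
Variable R : idomainType.
Implicit Types (P N : {poly R}) (S : seq R).

(* The quotient and the remainder of [P] by [N] are again translation invariant;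
   the remainder has degree less than [size S], so it is constant. *)
Lemma translation_invariant_comp N S : N \is monic -> size N = (size S).+1 ->
  (0 < size S)%N -> uniq S -> {in S, forall s, N \Po ('X + s%:P) = N} ->
  forall P, {in S, forall s, P \Po ('X + s%:P) = P} -> exists Q, P = Q \Po N.
Proof.
move=> monN sN sS uS invN P; have [n] := ubnP (size P).
elim: n P => // n IHn P lePn invP.
have const (T : {poly R}) : (size T <= size S)%N -> {in S, forall s, T \Po ('X + s%:P) = T} ->
    T = (T`_0)%:P.
  move=> sT invT; apply/eqP; rewrite -subr_eq0; apply/eqP.
  apply: (@roots_geq_poly_eq0 _ _ S) => //.
    apply/allP => s sS'; rewrite /root !hornerE -horner_coef0 subr_eq0.
    by rewrite -{2}(invT s sS') horner_comp !hornerE ?add0r.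
  rewrite (leq_trans (size_polyD _ _)) // size_polyN geq_max sT.
  by rewrite (leq_trans (size_polyC_leq1 _)).
have [sP|sP] := leqP (size P) (size S).
  by exists (P`_0)%:P; rewrite comp_polyC; apply: const.
have N0 : N != 0 := monic_neq0 monN.
pose q := Pdiv.CommonRing.rdivp P N; pose r := Pdiv.CommonRing.rmodp P N.
have eP : P = q * N + r := Pdiv.RingMonic.rdivp_eq monN P.
have sr : (size r <= size S)%N by rewrite -ltnS -sN Pdiv.CommonRing.ltn_rmodp.
have shift s : s \in S -> q \Po ('X + s%:P) = q /\ r \Po ('X + s%:P) = r.
  move=> sS'; have sX : size ('X + s%:P) = 2%N by rewrite size_XaddC.
  have := invP s sS'; rewrite {1}eP comp_polyD comp_polyM (invN s sS') {1}eP => E.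
  have E2 : (q \Po ('X + s%:P) - q) * N = r - (r \Po ('X + s%:P)).
    by rewrite mulrBl; apply/eqP; rewrite subr_eq addrAC eq_sym subr_eq E; apply/eqP; ring.
  have E3 : q \Po ('X + s%:P) - q = 0.
    apply/eqP/negPn/negP => D0.
    have := congr1 (fun p : {poly R} => size p) E2.
    rewrite size_Mmonic // sN addnS /= => E4.
    have : (size (r - (r \Po ('X + s%:P)))%R <= size S)%N.
      rewrite (leq_trans (size_polyD _ _)) // size_polyN size_comp_poly2 //.
      by rewrite maxnn.
    by rewrite -E4 -{2}[size S]add0n leq_add2r leqn0 size_poly_eq0 (negbTE D0).
  split; first by apply/eqP; rewrite -subr_eq0 E3.
  by move: E2; rewrite E3 mul0r => /esym/eqP; rewrite subr_eq0 => /eqP.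
have er : r = (r`_0)%:P by apply: const => // s /shift[].
have [|s /shift[]//|Q eQ] := IHn q.
  have q0 : q != 0.
    by apply: contraTneq sP => q0; rewrite -leqNgt eP q0 mul0r add0r.
  have : size P = (size q + size S)%N.
    have sqN : size (q * N)%R = (size q + size S)%N by rewrite size_Mmonic // sN addnS.
    rewrite eP size_polyDl ?sqN // (leq_ltn_trans sr) //.
    by rewrite -[X in (X < _)%N]add0n ltn_add2r size_poly_gt0.
  by move: lePn; rewrite ltnS => /[swap] -> /(leq_trans _) -> //; rewrite -{1}[size q]addn0 ltn_add2l.
exists (Q * 'X + (r`_0)%:P).
by rewrite comp_polyD comp_polyM comp_polyX comp_polyC -eQ -er.
Qed.

End TranslationInvariant.

(** * Frobenius powers and the elements of F_q in K *)

Section Fq.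
Variables (K : closedFieldType) (p h : nat).
Hypotheses (p_pr : prime p) (h_gt0 : (0 < h)%N) (pcharK : p \in [pchar K]).
Let q := (p ^ h)%N.

Lemma q_gt1 : (1 < q)%N.
Proof. by rewrite /q -(exp1n h) ltn_exp2r // prime_gt1. Qed.

Section Frobenius.
Variables (R : comNzRingType) (charR : p \in [pchar R]).

Lemma frobD (x y : R) e : (x + y) ^+ (p ^ e) = x ^+ (p ^ e) + y ^+ (p ^ e).
Proof.
apply: exprDn_pchar; apply/andP; split; first by rewrite expn_gt0 prime_gt0.
apply/allP => r; rewrite mem_primes => /and3P[r_pr _ ].
rewrite Euclid_dvdX // => /andP[]; rewrite dvdn_prime2 // => /eqP -> _.
exact: charR.
Qed.

Lemma frobN (x : R) e : (- x) ^+ (p ^ e) = - x ^+ (p ^ e).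
Proof.
apply/eqP; rewrite -subr_eq0 opprK -frobD addNr expr0n.
by rewrite expn_eq0 -leqn0 leqNgt prime_gt0.
Qed.

Lemma frobB (x y : R) e : (x - y) ^+ (p ^ e) = x ^+ (p ^ e) - y ^+ (p ^ e).
Proof. by rewrite frobD frobN. Qed.

Lemma frobq_sum (I : Type) (r : seq I) (P : pred I) (F : I -> R) e :
  (\sum_(i <- r | P i) F i) ^+ (p ^ e) = \sum_(i <- r | P i) F i ^+ (p ^ e).
Proof.
apply: (big_morph (fun x => x ^+ (p ^ e)) (fun x y => frobD x y e)).
by rewrite expr0n expn_eq0 -leqn0 leqNgt prime_gt0.
Qed.
End Frobenius.

(** The derivative of X^q - X is -1, so its q roots are distinct. *)
Lemma Fq_seq : exists fq : seq K, [/\ uniq fq, size fq = q,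
   forall a, (a \in fq) = (a ^+ q == a) &
   'X^q - 'X = \prod_(a <- fq) ('X - a%:P)].
Proof.
have sP : size ('X^q - 'X : {poly K}) = q.+1.
  by rewrite size_polyDl size_polyXn // size_polyN size_polyX ltnS q_gt1.
have [r er] := closed_field_poly_normal ('X^q - 'X : {poly K}).
have lc : lead_coef ('X^q - 'X : {poly K}) = 1.
  by rewrite lead_coefDl ?lead_coefXn // size_polyXn size_polyN size_polyX ltnS q_gt1.
rewrite lc scale1r in er.
exists r; split=> //.
- rewrite -separable_prod_XsubC -er separable_poly.unlock derivB derivXn derivX.
  have -> : 'X^(q.-1) *+ q = 0 :> {poly K}.
    have qK : q%:R = 0 :> K.
      by rewrite /q natrX (pcharf0 pcharK) expr0n gtn_eqF.
    by rewrite -mulr_natr -polyC_natr qK polyC0 mulr0.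
  rewrite sub0r; apply: coprimep_dvdl (coprimep1 _).
  by apply/dvdpP; exists (-1); rewrite mulrNN mulr1.
- by apply/eqP; rewrite -eqSS -sP er size_prod_XsubC.
- by move=> a; rewrite -root_prod_XsubC -er /root !hornerE subr_eq0.
Qed.

End Fq.

Section RootProducts.
Variable K : fieldType.

Lemma prod_XsubC_exp_dvd (s : seq K) k (f : {poly K}) : uniq s ->
  {in s, forall a, ('X - a%:P) ^+ k %| f} ->
  \prod_(a <- s) ('X - a%:P) ^+ k %| f.
Proof.
elim: s => [|a s IHs] /=; first by rewrite big_nil dvd1p.
move=> /andP[as' us] H; rewrite big_cons Gauss_dvdp.
  by rewrite H ?mem_head // IHs // => b bs; apply: H; rewrite in_cons bs orbT.
rewrite coprimep_expl // coprimep_sym coprimep_XsubC /root horner_prod.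
rewrite prodf_seq_neq0; apply/allP => b bs; rewrite /= horner_exp hornerXsubC.
by rewrite expf_neq0 // subr_eq0; apply: contraNneq as' => ->.
Qed.

Lemma size_prod_XsubC_exp (s : seq K) k :
  size (\prod_(a <- s) ('X - a%:P) ^+ k) = (size s * k).+1.
Proof.
elim: s => [|a s IHs] /=; first by rewrite big_nil size_poly1.
have nz : ('X - a%:P) ^+ k != 0 by rewrite expf_neq0 // polyXsubC_eq0.
rewrite big_cons size_Mmonic // ?IHs ?size_exp_XsubC; first by rewrite mulSn addnS.
by apply: monic_prod => b _; rewrite monic_exp ?monicXsubC.
Qed.

Lemma leq_roots_exp_size (s : seq K) k (f : {poly K}) : f != 0 -> uniq s ->
  {in s, forall a, ('X - a%:P) ^+ k %| f} -> (size s * k < size f)%N.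
Proof.
move=> f0 us H; rewrite -size_prod_XsubC_exp.
by apply: dvdp_leq => //; apply: prod_XsubC_exp_dvd.
Qed.

End RootProducts.

Lemma cubeB_factor q : (0 < q)%N -> (q ^ 3 - q = q.+1 * (q * q.-1))%N.
Proof. by case: q => // m _; rewrite !expnS expn0 /=; nia. Qed.

Lemma cubeB_square q : (q ^ 3 - q ^ 2 = q ^ 2 * q.-1)%N.
Proof. by rewrite !expnS expn0 -subn1; nia. Qed.

Lemma ltn_cube_double q : (1 < q)%N -> (q ^ 3 - q < 2 * (q ^ 3 - q ^ 2))%N.
Proof.
case: q => [|[|m]] // _; rewrite cubeB_square cubeB_factor // !expnS expn0 /=.
by nia.
Qed.

(** * Binary forms invariant under GL(2,q) *)

Section Invariants.
Variables (K : closedFieldType) (p h : nat).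
Hypotheses (p_pr : prime p) (h_gt0 : (0 < h)%N) (pcharK : p \in [pchar K]).
Let q := (p ^ h)%N.
Let q1 : (1 < q)%N := q_gt1 p_pr h_gt0.

(** A root count replaces cyclicity of the multiplicative group: with r = k mod (q - 1), the q - 1
    nonzero elements of F_q are roots of X^r - 1, so r = 0. *)
Lemma Fq_exp_dvdn k :
  (forall a : K, a ^+ q = a -> a != 0 -> a ^+ k = 1) -> (q.-1 %| k)%N.
Proof.
move=> H; have [fq [ufq sfq mfq _]] := Fq_seq p_pr h_gt0 pcharK.
rewrite /dvdn; apply/negPn/negP; rewrite -lt0n => r0.
set r := (k %% q.-1)%N in r0.
have rq : (r < q.-1)%N by rewrite ltn_mod -ltnS prednK // (ltn_trans _ q1).
have z0 : 0 \in fq by rewrite mfq expr0n gtn_eqF ?eqxx // (ltn_trans _ q1).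
have sr : size (rem 0 fq) = q.-1 by rewrite size_rem // sfq.
have : (size (rem 0%R fq) < size ('X^r - 1%:P : {poly K})%R)%N.
  apply: max_poly_roots; last exact: rem_uniq.
    by rewrite -size_poly_eq0 size_XnsubC.
  apply/allP => a; rewrite mem_rem_uniq // inE /= mfq => /andP[a0 /eqP aq].
  have a1 : a ^+ q.-1 = 1.
    by apply: (mulfI a0); rewrite -exprS prednK ?mulr1 // (ltn_trans _ q1).
  rewrite /root !hornerE subr_eq0; apply/eqP.
  by rewrite -(H a aq a0) (divn_eq k q.-1) exprD mulnC exprM a1 expr1n mul1r.
by rewrite sr size_XnsubC // ltnS leqNgt rq.
Qed.

Section Additive.
Variables (R : idomainType) (iota : {rmorphism K -> R}) (z : R).
Hypothesis z0 : z != 0.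

(** The inner polynomial is the product of all X - a z with a in F_q. Keeping [z] in the base ring
    allows it to be an indeterminate, later specialised to 0. *)
Lemma translation_invariant_Fq (P : {poly R}) :
  (forall a : K, a ^+ q = a -> P \Po ('X + (iota a * z)%:P) = P) ->
  exists Q, P = Q \Po ('X^q - z ^+ q.-1 *: 'X).
Proof.
move=> invP; have [fq [ufq sfq mfq _]] := Fq_seq p_pr h_gt0 pcharK.
set N := _ - _.
have szX : (size (- (z ^+ q.-1 *: 'X) : {poly R})%R < size ('X^q : {poly R})%R)%N.
  by rewrite size_polyXn size_polyN (leq_ltn_trans (size_scale_leq _ _)) // size_polyX ltnS.
have charR : p \in [pchar R] := rmorph_pchar iota pcharK.
have charPR : p \in [pchar {poly R}] := rmorph_pchar (@polyC R) charR.
apply: (@translation_invariant_comp _ N [seq iota a * z | a <- fq]).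
- by rewrite monicE lead_coefDl // lead_coefXn.
- by rewrite size_polyDl // size_polyXn size_map sfq.
- by rewrite size_map sfq (ltn_trans _ q1).
- rewrite map_inj_in_uniq // => a b _ _ /(mulIf z0) e.
  exact: fmorph_inj e.
- move=> s /mapP[a ain ->]; move: ain; rewrite mfq => /eqP aq.
  rewrite /N comp_polyB comp_polyZ (rmorphXn (comp_poly _)) /= comp_polyX.
  rewrite (frobD p_pr charPR) -polyC_exp exprMn -(rmorphXn iota) /= aq scalerDr scale_polyC.
  have -> : z ^+ q = z ^+ q.-1 * z by rewrite -exprSr prednK // (ltn_trans _ q1).
  by rewrite mulrCA; ring.
- by move=> s /mapP[a ain ->]; apply: invP; apply/eqP; rewrite -mfq.
Qed.

End Additive.

Lemma translation_invariant_Fq1 (P : {poly K}) :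
  (forall a : K, a ^+ q = a -> P \Po ('X + a%:P) = P) ->
  exists Q, P = Q \Po ('X^q - 'X).
Proof.
move=> H; have [a aq|Q ->] := @translation_invariant_Fq K idfun 1 (oner_neq0 _) P.
  by rewrite mulr1; apply: H.
by exists Q; rewrite expr1n scale1r.
Qed.

(* A dehomogenised binary form [f(x,1)] of degree [n] invariant under GL(2,q)
   and lying in [K[x^q]]. *)
Lemma binary_form_degree (f : {poly K}) n : (0 < n)%N -> f != 0 ->
  (size f <= n.+1)%N ->
  (forall i, (i <= n)%N -> f`_i = (-1) ^+ i * f`_(n - i)) ->
  (forall a : K, a ^+ q = a -> f \Po ('X + a%:P) = f) ->
  (forall a x : K, a ^+ q = a -> a != 0 -> f.[a * x] = f.[x]) ->
  (exists g, f = g \Po 'X^q) ->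
  f.[0] != 0 /\ (q ^ 2 * q.-1 %| n)%N \/ f.[0] = 0 /\ (q ^ 3 - q <= n)%N.
Proof.
move=> n0 f0 sf symf trf scf [g eg].
have q0 : (0 < q)%N := ltnW q1.
have coefsc a i : a ^+ q = a -> a != 0 -> f`_i * a ^+ i = f`_i.
  move=> aq a0; have E : \poly_(j < size f) (f`_j * a ^+ j) = f.
    apply/eqP; rewrite -subr_eq0; apply/eqP; apply: poly_eq0_of_roots => x.
    rewrite hornerD hornerN horner_poly -(scf a x aq a0) horner_coef -sumrB big1 // => j _.
    by rewrite exprMn mulrA subrr.
  rewrite -{2}E coef_poly; case: ltnP => // le.
  by rewrite nth_default ?mul0r.
have qm1 i : f`_i != 0 -> (q.-1 %| i)%N.
  move=> fi; apply: Fq_exp_dvdn => a aq a0; apply: (mulfI fi).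
  by rewrite coefsc // mulr1.
have qm i : f`_i != 0 -> (q %| i)%N.
  by rewrite eg coef_comp_poly_Xn //; case: ifP => //; rewrite eqxx.
have fn : (f`_n != 0) = (f`_0 != 0).
  by rewrite symf // subnn mulf_eq0 signr_eq0.
have copq : coprime q q.-1.
  by rewrite -{1}(prednK q0) coprimeSn.
have [e0|n00] := eqVneq f.[0] 0; [right|left]; split=> //.
- have [j [f1]] := multiplicity_XsubC f 0; rewrite f0 /= => nr1 ef.
  have j0 : (0 < j)%N.
    rewrite lt0n; apply: contra nr1 => /eqP j0; rewrite /root; apply/eqP.
    by move: e0; rewrite ef j0 expr0 mulr1.
  have fj i : (i < j)%N -> f`_i = 0.
    by move=> lt; rewrite ef subr0 coefMXn lt.
  have fj0 : f`_j != 0.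
    by rewrite ef subr0 coefMXn ltnn subnn -horner_coef0.
  have jn : (j <= n)%N.
    by rewrite leqNgt; apply: contra fj0 => lt; rewrite nth_default // (leq_trans sf).
  have sfj : (size f <= (n - j).+1)%N.
    apply/leq_sizeP => i lt; have [le|gt] := leqP i n.
      by rewrite symf // fj ?mulr0 //; lia.
    by rewrite nth_default // (leq_trans sf).
  have dj : (q * q.-1 %| j)%N by rewrite Gauss_dvd // qm // qm1.
  have lej : (q * q.-1 <= j)%N by apply: dvdn_leq.
  have [fq [ufq sfq mfq _]] := Fq_seq p_pr h_gt0 pcharK.
  have : (size fq * j < size f)%N.
    apply: leq_roots_exp_size => // a; rewrite mfq => /eqP aq.
    have naq : (- a) ^+ q = - a by rewrite /q (frobN p_pr pcharK) aq.
    apply/dvdpP; exists (f1 \Po ('X - a%:P)).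
    rewrite -{1}(trf _ naq) polyCN {1}ef comp_polyM rmorphXn /= subr0.
    by rewrite comp_polyX.
  rewrite sfq => lt; have le : (q * j + j <= n)%N by lia.
  apply: leq_trans le; rewrite -mulSnr cubeB_factor //.
  exact: leq_mul.
- rewrite horner_coef0 -fn in n00.
  have sfn : size f = n.+1.
    apply/eqP; rewrite eqn_leq sf /= ltnNge; apply: contra n00 => le.
    by rewrite nth_default.
  (* Since a = a^q, translating x by a translates x^q by a, so [g] is translation invariant as well
     and f = w(x^(q^2) - x^q). *)
  have [a aq|w ew] := @translation_invariant_Fq1 g.
    apply/eqP; rewrite -subr_eq0 -(@comp_poly_eq0 _ _ 'X^q) ?size_polyXn //.
    rewrite comp_polyB subr_eq0 -eg -(trf a aq) eg -!comp_polyA; apply/eqP.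
    congr (_ \Po _); rewrite comp_polyD comp_polyX comp_polyC (rmorphXn (comp_poly _)) /= comp_polyX.
    have charPR : p \in [pchar {poly K}] := rmorph_pchar (@polyC K) pcharK.
    by rewrite (frobD p_pr charPR) -polyC_exp aq.
  have sN : size ('X^q - 'X : {poly K}) = q.+1.
    by rewrite size_polyDl size_polyXn // size_polyN size_polyX ltnS.
  have en : n = ((size w).-1 * q * q)%N.
    have -> : n = (size f).-1 by rewrite sfn.
    by rewrite eg size_comp_poly ew size_comp_poly size_polyXn sN.
  have c2 : coprime (q ^ 2) q.-1 by rewrite coprimeXl.
  rewrite Gauss_dvd //; apply/andP; split; last exact: qm1.
  by rewrite en -mulnA mulnn dvdn_mull.
Qed.
End Invariants.

(** * Transvections and the swaps they generate *)

Section Transvections.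
Variable K : fieldType.

(* [v *m transvection i j a] adds [a] times coordinate [i] to coordinate [j]. *)
Definition transvection (i j : 'I_3) (a : K) : 'M[K]_3 := 1%:M + a *: delta_mx i j.

Variables (R : comNzRingType) (f : {rmorphism K -> R}).
Implicit Types (F : {mpoly K[3]}) (x y z : R) (a : K).

Ltac ev_trv := rewrite ev_act /transvection !mxE /=
   !(mulr0n, mulr1n, mulr0, mulr1, addr0, add0r, rmorph0, rmorph1, mul0r, mul1r).

Lemma ev_trv_zx x y z a F : ev f x y z (act (transvection i2 i0 a) F) = ev f (x + f a * z) y z F.
Proof. by ev_trv. Qed.
Lemma ev_trv_yx x y z a F : ev f x y z (act (transvection i1 i0 a) F) = ev f (x + f a * y) y z F.
Proof. by ev_trv. Qed.
Lemma ev_trv_zy x y z a F : ev f x y z (act (transvection i2 i1 a) F) = ev f x (y + f a * z) z F.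
Proof. by ev_trv. Qed.
Lemma ev_trv_xy x y z a F : ev f x y z (act (transvection i0 i1 a) F) = ev f x (f a * x + y) z F.
Proof. by ev_trv. Qed.
Lemma ev_trv_xz x y z a F : ev f x y z (act (transvection i0 i2 a) F) = ev f x y (f a * x + z) F.
Proof. by ev_trv. Qed.
Lemma ev_trv_yz x y z a F : ev f x y z (act (transvection i1 i2 a) F) = ev f x y (f a * y + z) F.
Proof. by ev_trv. Qed.

End Transvections.

(** The map (x, y) -> (c y, -c' x) is a product of three transvections. Varying [c] also yields the
    diagonal scalings, as quotients of two such swaps. *)
Lemma sl2_swap (R : comNzRingType) (T : Type) (f : R -> R -> T) (c c' : R) :
  c * c' = 1 ->
  (forall x y, f (x + c * y) y = f x y) -> (forall x y, f x (- c' * x + y) = f x y) ->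
  forall x y, f (c * y) (- c' * x) = f x y.
Proof.
move=> cc' fl fr x y; rewrite -[RHS]fl -[RHS]fr.
have -> : - c' * (x + c * y) + y = - c' * x + (1 - c * c') * y by ring.
rewrite cc' subrr mul0r addr0 -[RHS]fl; congr f.
have -> : x + c * y + c * (- c' * x) = (1 - c * c') * x + c * y by ring.
by rewrite cc' subrr mul0r add0r.
Qed.

(** * Factors of forms are forms *)

Section HomogeneousFactor.
Variable K : closedFieldType.

Lemma monomial_factor (R : idomainType) (P Q : {poly R}) (c : R) n : c != 0 ->
  P * Q = c *: 'X^n -> exists a i, P = a *: 'X^i /\ (i <= n)%N.
Proof.
move=> c0; have X0 : 'X != 0 :> {poly R} by rewrite polyX_eq0.
elim: n P Q => [|n IHn] P Q e.
  have P0 : P != 0.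
    by apply: contraNneq c0 => P0; rewrite -(polyC_eq0 c) -alg_polyC -e P0 mul0r.
  have Q0 : Q != 0.
    by apply: contraNneq c0 => Q0; rewrite -(polyC_eq0 c) -alg_polyC -e Q0 mulr0.
  have := congr1 (fun p : {poly R} => size p) e.
  rewrite expr0 alg_polyC size_polyC c0 size_mul // => sz.
  have sP : (size P <= 1)%N.
    by move: sz; rewrite (polySpred P0) (polySpred Q0); case: (size P).-1 => //= m; rewrite !addSn addnS.
  by exists P`_0, 0%N; rewrite expr0 alg_polyC -size1_polyC.
have : (P * Q).[0] = 0 by rewrite e !hornerE expr0n mulr0.
rewrite hornerM => /eqP; rewrite mulf_eq0 => /orP[] /factor_theorem[P' eP'].
- have [|a [i [ea li]]] := IHn P' Q.
    apply: (mulIf X0).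
    by rewrite -scalerAl -exprSr -e eP' subr0 mulrAC.
  exists a, i.+1; split=> //.
  by rewrite eP' subr0 ea exprSr scalerAl.
- have [|a [i [ea li]]] := IHn P P'.
    apply: (mulIf X0).
    by rewrite -scalerAl -exprSr -e eP' subr0 mulrA.
  by exists a, i; split=> //; apply: leqW.
Qed.

Lemma monomial_factors (R : idomainType) (P Q : {poly R}) (c : R) n : c != 0 ->
  P * Q = c *: 'X^n ->
  exists a b i, [/\ (i <= n)%N, P = a *: 'X^i & Q = b *: 'X^(n - i)].
Proof.
move=> c0 e; have [a [i [ea li]]] := monomial_factor c0 e.
have e' := e; rewrite mulrC in e'; have [b [j [eb lj]]] := monomial_factor c0 e'.
exists a, b, i; split=> //; suff -> : (n - i)%N = j by [].
have E : (a * b) *: 'X^(i + j) = c *: 'X^n :> {poly R}.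
  by rewrite -e ea eb -scalerAl -scalerAr scalerA -exprD.
have ab0 : a * b != 0.
  apply: contraNneq c0 => ab0; move: E; rewrite ab0 scale0r => /esym/eqP.
  by rewrite -mul_polyC mulf_eq0 polyC_eq0 -[_ ^+ _ == 0]size_poly_eq0 size_polyXn orbF.
move/(congr1 (fun P : {poly R} => size P)): E.
by rewrite !size_scale // !size_polyXn => -[<-]; rewrite addKn.
Qed.

(** Comparing coefficients gives c^(mdeg m) = c^n for every [c] whenever [m] occurs in [F]; as K is
    infinite, the exponents agree. *)
Lemma homog_of_scale (F : {mpoly K[3]}) n :
  (forall c v, F.@[fun i => c * v i] = c ^+ n * F.@[v]) -> F \is n.-homog.
Proof.
move=> H; apply/dhomogP => m mF; apply/eqP; apply/negPn/negP => ne.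
have E c : (c ^+ mdeg m - c ^+ n) * F@_m = 0.
  pose G := \sum_(m' <- msupp F) ((c ^+ mdeg m' - c ^+ n) * F@_m') *: 'X_[m'].
  have G0 : G = 0.
    apply: mpoly_eq0_of_meval => v.
    have : F.@[fun i => c * v i] - c ^+ n * F.@[v] = 0 by rewrite H subrr.
    rewrite [F.@[v]]mevalE mevalE big_distrr -sumrB => <-; rewrite /G raddf_sum.
    apply: eq_bigr => m' _; rewrite /= mevalZ mevalX.
    have -> : \prod_i (c * v i) ^+ m' i = c ^+ mdeg m' * \prod_i v i ^+ m' i.
      by rewrite mdegE -prodrXr -big_split; apply: eq_bigr => i _; rewrite exprMn.
    by rewrite mulrBl mulrBl; congr (_ - _); rewrite ?mulrA // [c ^+ _ * _]mulrC.
  have := congr1 (mcoeff m) G0; rewrite mcoeff0 /G raddf_sum (bigD1_seq m) ?msupp_uniq //=.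
  rewrite mcoeffZ mcoeffX eqxx mulr1 big1 ?addr0 // => m' ne'.
  by rewrite mcoeffZ mcoeffX (negbTE ne') mulr0.
have Fm : F@_m != 0 by rewrite mcoeff_eq0 negbK.
have : 'X^(mdeg m) - 'X^n = 0 :> {poly K}.
  apply: poly_eq0_of_roots => c; rewrite !hornerE.
  by apply: (mulIf Fm); rewrite E mul0r.
move/eqP; rewrite subr_eq0 => /eqP/(congr1 (fun p : {poly K} => size p)).
by rewrite !size_polyXn => -[] e; move/eqP: ne; apply; exact: e.
Qed.

Let R := {mpoly K[3]}.
Let iota : {rmorphism K -> {poly R}} := @polyC R \o @mpolyC 3 K.

Lemma ev_mpolyC_id (F : R) : ev (@mpolyC 3 K) 'X_i0 'X_i1 'X_i2 F = F.
Proof.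
apply: mpoly_eq_of_meval => v.
rewrite (@ev_morph _ _ _ _ idfun (meval v)) => [|c]; last exact: mevalC.
by rewrite /= !mevalXU -[RHS]ev0_coords.
Qed.

(** Multiplies the three variables by a new variable T. Forms of degree n are exactly the
    polynomials that become monomials in T of degree n, and factors of a monomial are monomials. *)
Let scale (F : R) := ev iota ('X * ('X_i0)%:P) ('X * ('X_i1)%:P) ('X * ('X_i2)%:P) F.

Lemma scale_homog F n : F \is n.-homog -> scale F = F *: 'X^n.
Proof.
move=> hF; rewrite /scale (ev_homog _ _ _ _ _ hF) mulrC -mul_polyC; congr (_ * _).
by rewrite -(@ev_morph _ _ _ (@mpolyC 3 K)) // ev_mpolyC_id.
Qed.

Lemma homog_of_scaleE (F G : R) i : scale F = G *: 'X^i -> F \is i.-homog.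
Proof.
move=> e.
have H c v : F.@[fun i => c * v i] = c ^+ i * G.@[v].
  have [phi phiC phiX] : exists2 phi : {rmorphism {poly R} -> K},
      (forall P : R, phi P%:P = P.@[v]) & phi 'X = c.
    exists (meval v \o horner_eval c%:MP); first by move=> P; rewrite /= horner_evalE hornerC.
    by rewrite /= horner_evalE hornerX mevalC.
  have phiXC (P : R) : phi ('X * P%:P) = c * P.@[v] by rewrite rmorphM phiX phiC.
  have : phi (scale F) = phi (G *: 'X^i) by rewrite e.
  rewrite -mul_polyC rmorphM rmorphXn phiX phiC mulrC => <-.
  rewrite /scale (@ev_morph _ _ _ iota idfun phi) => [|d]; last by rewrite phiC mevalC.
  have E j : phi ('X * ('X_j)%:P) = c * v j by have := phiXC 'X_j; rewrite mevalXU.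
  have := ev0_coords (fun i => c * v i) F; rewrite /ev0 => <-.
  by rewrite -(E i0) -(E i1) -(E i2).
apply: homog_of_scale => c v; rewrite H; congr (_ * _).
by have := H 1 v; rewrite expr1n mul1r => <-; apply: meval_eq => j; rewrite mul1r.
Qed.

Lemma homog_factor (F G : R) n : F * G != 0 -> F * G \is n.-homog ->
  exists i, [/\ (i <= n)%N, F \is i.-homog & G \is (n - i).-homog].
Proof.
move=> FG0 /scale_homog; rewrite /scale rmorphM -!/(scale _) => e.
have [a [b [i [li ea eb]]]] := monomial_factors FG0 e.
by exists i; split; [|exact: homog_of_scaleE ea|exact: homog_of_scaleE eb].
Qed.

End HomogeneousFactor.

(** * Degrees of SL(3,q)-invariant forms *)

Section Lines.
Variable K : closedFieldType.
Implicit Types F : {mpoly K[3]}.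

Definition line_poly (y z : K) F : {poly K} := ev (@polyC K) 'X y%:P z%:P F.

Lemma line_polyE y z F x : (line_poly y z F).[x] = ev0 x y z F.
Proof.
rewrite -horner_evalE (@ev_morph _ _ _ _ idfun (horner_eval x)) => [|c].
  by rewrite /= !horner_evalE hornerX !hornerC.
by rewrite /= horner_evalE hornerC.
Qed.

Lemma size_line_poly y z F n : F \is n.-homog -> (size (line_poly y z F) <= n.+1)%N.
Proof.
move=> hF; rewrite /line_poly /ev /mmap.
rewrite big_seq; apply: (leq_trans (size_sum _ _ _)); apply/bigmax_leqP_seq => m mF _.
have dm : mdeg m = n := dhomog_mf hF mF.
rewrite mul_polyC (leq_trans (size_scale_leq _ _)) // /mmap1 !big_ord_recl big_ord0.
rewrite /coords /= mulr1 -!polyC_exp -polyCM mulrC mul_polyC.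
rewrite (leq_trans (size_scale_leq _ _)) // size_polyXn ltnS -dm mdegE.
by rewrite big_ord_recl leq_addr.
Qed.

Lemma ev0_homog c x y z F n : F \is n.-homog ->
  ev0 (c * x) (c * y) (c * z) F = c ^+ n * ev0 x y z F.
Proof. exact: ev_homog. Qed.

Lemma homog0_unit F : F != 0 -> F \is 0.-homog -> F \is a GRing.unit.
Proof.
move=> F0 hF; have [c ec] : exists c, F = c%:MP.
  exists F.@[fun=> 0]; apply: mpoly_eq_of_meval => v; rewrite mevalC.
  have := ev0_homog 0 (v i0) (v i1) (v i2) hF; rewrite expr0 mul1r !mul0r => E.
  by rewrite -ev0_coords -E -[RHS]ev0_coords.
by rewrite mpoly_unitE ec msizeC; move: F0; rewrite ec mpolyC_eq0 => ->.
Qed.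

Lemma ev0_line F n x y : F \is n.-homog -> y != 0 ->
  ev0 x y 0 F = y ^+ n * (line_poly 1 0 F).[x / y].
Proof.
move=> hF y0; rewrite line_polyE -(ev0_homog _ _ _ _ hF) mulr1 mulr0.
by rewrite mulrC divfK.
Qed.

Lemma ev0_eq0_of_dense F (P : {mpoly K[3]}) : P != 0 ->
  (forall v, P.@[v] != 0 -> F.@[v] = 0) -> F = 0.
Proof.
move=> P0 H; apply/eqP; have : F * P == 0.
  apply/eqP/mpoly_eq0_of_meval => v; rewrite mevalM.
  by have [->|/H ->] := eqVneq P.@[v] 0; rewrite ?mulr0 ?mul0r.
by rewrite mulf_eq0 (negbTE P0) orbF.
Qed.

Lemma mpolyX_irreducible n (i : 'I_n) : irreducible_elt ('X_i : {mpoly K[n]}).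
Proof.
have X0 : 'X_i != 0 :> {mpoly K[n]} by rewrite -msize_poly_eq0 msizeX.
have sX : msize ('X_i : {mpoly K[n]}) = 2%N by rewrite msizeX mdeg1.
split=> // [|b c e]; first by rewrite mpoly_unitE sX.
have b0 : b != 0 by apply: contraNneq X0 => b0; rewrite e b0 mul0r.
have c0 : c != 0 by apply: contraNneq X0 => c0; rewrite e c0 mulr0.
have := mpoly_degM b0 c0; rewrite -e sX /= => /esym/eqP.
rewrite addn_eq1 => /orP[] /andP[/eqP db /eqP dc].
  by right; apply: mpoly_deg0_unit.
by left; apply: mpoly_deg0_unit.
Qed.

Lemma line_poly_eq0_rdvd F n : F \is n.-homog -> line_poly 1 0 F = 0 ->
  rdvd 'X_i2 F.
Proof.
move=> hF l0; apply: irreducible_rdvd_of_zeros; first exact: mpolyX_irreducible.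
move=> v; rewrite mevalXU => vz.
have P0 : 'X_i1 != 0 :> {mpoly K[3]} by case: (@mpolyX_irreducible 3 i1).
pose G := F \mPo [tuple 'X_i0; 'X_i1; 0].
have GE w : G.@[w] = ev0 (w i0) (w i1) 0 F.
  by rewrite -[LHS]ev0_coords /ev0 ev_comp /= !evX rmorph0.
suff G0 : G = 0 by rewrite -ev0_coords vz -GE G0 meval0.
apply: (ev0_eq0_of_dense P0) => w; rewrite mevalXU GE => w1.
by rewrite (ev0_line _ hF w1) l0 horner0 mulr0.
Qed.

End Lines.

Section SLInvariants.
Variables (K : closedFieldType) (p h : nat).
Hypotheses (p_pr : prime p) (h_gt0 : (0 < h)%N) (pcharK : p \in [pchar K]).
Let q := (p ^ h)%N.
Let q1 : (1 < q)%N := q_gt1 p_pr h_gt0.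
Implicit Types F : {mpoly K[3]}.

(** The form itself is fixed, not just its zero set; the transvections over F_q generate SL(3,q). *)
Definition SLinvariant F :=
  forall i j (a : K), i != j -> a ^+ (p ^ h) = a -> act (transvection i j a) F = F.

Let q_gt0 : (0 < q)%N. Proof. exact: ltnW. Qed.

Lemma FqN (a : K) : a ^+ q = a -> (- a) ^+ q = - a.
Proof. by move=> aq; rewrite /q (frobN p_pr pcharK) -/q aq. Qed.

Lemma Fq1 : 1 ^+ q = 1 :> K. Proof. exact: expr1n. Qed.

(* The subgroup generated by the elations [x -> x + a z] fixes the line [z = 0]
   pointwise, which forces the restriction to that line to lie in [K[x^q]]. *)
Lemma line_poly_Xq F :
  (forall a : K, a ^+ q = a -> act (transvection i2 i0 a) F = F) ->
  exists g, line_poly 1 0 F = g \Po 'X^q.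
Proof.
move=> inv; pose iota : {rmorphism K -> {poly {poly K}}} := polyC \o polyC.
(* [P] is F(X, 1, Z), invariant under X -> X + a Z and hence a polynomial in X^q - Z^(q-1) X, which
   becomes X^q at Z = 0. *)
pose P : {poly {poly K}} := ev iota 'X 1 ('X)%:P F.
have zX : 'X != 0 :> {poly K} by rewrite polyX_eq0.
have [a aq|Q eQ] := @translation_invariant_Fq K p h p_pr h_gt0 pcharK _ (@polyC K) 'X zX P.
  rewrite /P -[RHS]/(ev iota 'X 1 ('X)%:P F) -{2}(inv a aq) ev_trv_zx.
  rewrite (@ev_morph _ _ _ iota iota (comp_poly ('X + (a%:P * 'X)%:P))) => [|c]; last first.
    by rewrite /= comp_polyC.
  rewrite /= comp_polyX comp_polyC comp_polyC; congr ev.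
  by rewrite /iota /= polyCM.
exists (map_poly (horner_eval 0) Q).
have -> : line_poly 1 0 F = map_poly (horner_eval 0) P.
  rewrite /P (@ev_morph _ _ _ iota (@polyC K) (map_poly (horner_eval 0))) => [|c].
    by rewrite /= map_polyX rmorph1 map_polyC /= horner_evalE hornerX.
  by rewrite /iota /= map_polyC /= horner_evalE hornerC.
rewrite eQ map_comp_poly; congr (_ \Po _).
rewrite rmorphB rmorphXn /= map_polyX map_polyZ /= horner_evalE hornerXn.
have qm : (0 < q.-1)%N by rewrite -ltnS prednK.
by rewrite expr0n gtn_eqF // scale0r subr0.
Qed.

Lemma Fq_oppV (a : K) : a ^+ q = a -> (- a^-1) ^+ q = - a^-1.
Proof. by move=> aq; apply: FqN; rewrite exprVn aq. Qed.

Lemma swap_xy (R : comNzRingType) (iota : {rmorphism K -> R}) F a x y z :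
  (forall b : K, b ^+ q = b -> act (transvection i1 i0 b) F = F) ->
  (forall b : K, b ^+ q = b -> act (transvection i0 i1 b) F = F) ->
  a ^+ q = a -> a != 0 ->
  ev iota (iota a * y) (- iota a^-1 * x) z F = ev iota x y z F.
Proof.
move=> inv1 inv2 aq a0; apply: (@sl2_swap R R (fun x y => ev iota x y z F)).
- by rewrite -rmorphM divff // rmorph1.
- by move=> x' y'; rewrite -ev_trv_yx inv1.
- by move=> x' y'; rewrite -rmorphN -ev_trv_xy inv2 //; apply: Fq_oppV.
Qed.

Lemma swap_xz (R : comNzRingType) (iota : {rmorphism K -> R}) F a x y z :
  (forall b : K, b ^+ q = b -> act (transvection i2 i0 b) F = F) ->
  (forall b : K, b ^+ q = b -> act (transvection i0 i2 b) F = F) ->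
  a ^+ q = a -> a != 0 ->
  ev iota (iota a * z) y (- iota a^-1 * x) F = ev iota x y z F.
Proof.
move=> inv1 inv2 aq a0; apply: (@sl2_swap R R (fun x z => ev iota x y z F)).
- by rewrite -rmorphM divff // rmorph1.
- by move=> x' z'; rewrite -ev_trv_zx inv1.
- by move=> x' z'; rewrite -rmorphN -ev_trv_xz inv2 //; apply: Fq_oppV.
Qed.

Lemma line_poly_sym F n i : F \is n.-homog ->
  (forall b : K, b ^+ q = b -> act (transvection i1 i0 b) F = F) ->
  (forall b : K, b ^+ q = b -> act (transvection i0 i1 b) F = F) ->
  (i <= n)%N ->
  (line_poly 1 0 F)`_i = (-1) ^+ i * (line_poly 1 0 F)`_(n - i).
Proof.
move=> hF inv1 inv2 lein; set f := line_poly 1 0 F.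
have sf : (size f <= n.+1)%N := size_line_poly 1 0 hF.
pose g := \poly_(k < n.+1) ((-1) ^+ k * f`_(n - k)).
have fE x : x != 0 -> f.[x] = (- x) ^+ n * f.[- x^-1].
  move=> x0; have := ev0_line 1 hF (_ : - x != 0); rewrite oppr_eq0 => /(_ x0).
  rewrite mul1r invrN => <-; rewrite line_polyE.
  have := swap_xy idfun x 1 0 inv1 inv2 Fq1 (oner_neq0 K); rewrite /= invr1 !mul1r mulN1r.
  by move/esym.
(* The factor X takes care of x = 0, where the functional equation says nothing. *)
have E : (f - g) * 'X = 0.
  apply: poly_eq0_of_roots => x; rewrite !hornerE.
  have [->|x0] := eqVneq x 0; first by rewrite mulr0.
  rewrite fE // (horner_coef_wide _ sf) /g horner_poly big_distrr /=.
  rewrite (reindex_inj rev_ord_inj) /= -sumrB big1 ?mul0r // => k _.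
  rewrite subSS; have kn : (k <= n)%N by rewrite -ltnS.
  rewrite -{1}(subnK kn) exprD.
  have -> : (- x) ^+ (n - k) * (- x) ^+ k * (f`_(n - k) * (- x^-1) ^+ (n - k)) =
     ((- x) * (- x^-1)) ^+ (n - k) * (- x) ^+ k * f`_(n - k) by rewrite exprMn; ring.
  rewrite mulrNN divff // expr1n mul1r -[- x]mulN1r exprMn.
  by ring.
have /eqP : f - g == 0 by move/eqP: E; rewrite mulf_eq0 polyX_eq0 orbF.
move/eqP; rewrite subr_eq0 => /eqP /(congr1 (fun P : {poly K} => P`_i)).
by rewrite coef_poly ltnS lein.
Qed.

(** Stated for transvections that fix the coordinate z, since the cofactor of a power of z in an
    invariant form inherits just these. With d = deg f, symmetry makes both d and n - d exponents
    occurring in an element of K[x^q]. *)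
Lemma dvdn_degree_of_line F n : F \is n.-homog ->
  (forall b : K, b ^+ q = b -> act (transvection i2 i0 b) F = F) ->
  (forall b : K, b ^+ q = b -> act (transvection i1 i0 b) F = F) ->
  (forall b : K, b ^+ q = b -> act (transvection i0 i1 b) F = F) ->
  line_poly 1 0 F != 0 -> (q %| n)%N.
Proof.
move=> hF inv0 inv1 inv2 f0; have [g eg] := line_poly_Xq inv0.
set f := line_poly 1 0 F in f0 eg.
have qm i : f`_i != 0 -> (q %| i)%N.
  by rewrite eg coef_comp_poly_Xn //; case: ifP => //; rewrite eqxx.
pose d := (size f).-1.
have fd : f`_d != 0 by rewrite -/(lead_coef f) lead_coef_eq0.
have dn : (d <= n)%N.
  by rewrite -ltnS /d -polySpred //; apply: size_line_poly hF.
have fd' : f`_(n - d) != 0.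
  apply: contraNneq fd => fd'.
  by rewrite /f (line_poly_sym hF inv1 inv2 dn) -/f fd' mulr0.
by rewrite -(subnK dn) dvdn_addr qm.
Qed.

Lemma SLinvariant_degree F n : (0 < n)%N -> F \is n.-homog -> SLinvariant F ->
  line_poly 1 0 F != 0 ->
  (line_poly 1 0 F).[0] != 0 /\ (q ^ 2 * q.-1 %| n)%N \/
  (line_poly 1 0 F).[0] = 0 /\ (q ^ 3 - q <= n)%N.
Proof.
move=> n0 hF inv f0.
apply: (binary_form_degree p_pr h_gt0 pcharK) => //.
- exact: size_line_poly hF.
- by move=> i lein; apply: line_poly_sym => // b; apply: inv.
- move=> a aq; rewrite -[RHS]/(ev (@polyC K) 'X 1 0 F).
  rewrite /line_poly (@ev_morph _ _ _ (@polyC K) (@polyC K) (comp_poly ('X + a%:P))) => [|c].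
    rewrite /= comp_polyX !comp_polyC -{2}(inv i1 i0 a) // ev_trv_yx.
    by rewrite mulr1.
  by rewrite /= comp_polyC.
- move=> a x aq a0; rewrite !line_polyE.
  have E X b : b ^+ q = b -> b != 0 -> ev0 0 1 (- b^-1 * X) F = ev0 X 1 0 F.
    move=> bq b0; have := swap_xz idfun X 1 0 (inv i2 i0 ^~ isT) (inv i0 i2 ^~ isT) bq b0.
    by rewrite /= mulr0.
  rewrite -(E (a * x) a) // -(E x 1 Fq1 (oner_neq0 _)); congr ev0.
  by rewrite mulNr mulKf // invr1 mulN1r.
- by apply: line_poly_Xq => a; apply: inv.
Qed.

Lemma strip_z F : F != 0 -> exists k G, F = 'X_i2 ^+ k * G /\ ~ rdvd 'X_i2 G.
Proof.
have [n] := ubnP (msize F); elim: n F => // n IHn F leFn F0.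
have [[G eG]|nd] := classic (rdvd 'X_i2 F); last by exists 0%N, F; rewrite expr0 mul1r.
have G0 : G != 0 by apply: contraNneq F0 => G0; rewrite eG G0 mul0r.
have [X0 _ _] := @mpolyX_irreducible K 3 i2.
have sX : msize ('X_i2 : {mpoly K[3]}) = 2%N by rewrite msizeX mdeg1.
have [|k [H [eH nd]]] := IHn G _ G0.
  by move: leFn; rewrite eG msizeM // sX addn2.
by exists k.+1, H; split=> //; rewrite eG {1}eH exprS; ring.
Qed.

Lemma act_X_fix i j (a : K) k : k != j -> act (transvection i j a) 'X_k = 'X_k.
Proof.
move=> kj; apply: mpoly_eq_of_meval => v; rewrite /act comp_mpoly_meval !mevalXU tnth_mktuple.
rewrite raddf_sum (bigD1 k) //= big1 => [|l lk].
  by rewrite addr0 mevalZ mevalXU !mxE eqxx (negbTE kj) andbF mulr0 addr0 mul1r.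
by rewrite mevalZ !mxE (negbTE lk) (negbTE kj) andbF mulr0 addr0 mul0r.
Qed.

Lemma act_cancel_X i j (a : K) k (l : 'I_3) F : l != j ->
  act (transvection i j a) ('X_l ^+ k * F) = 'X_l ^+ k * F ->
  act (transvection i j a) F = F.
Proof.
move=> lj; rewrite rmorphM rmorphXn /= act_X_fix //.
by apply: mulfI; rewrite expf_neq0 //; case: (@mpolyX_irreducible K 3 l).
Qed.

(* If [F] vanished at an F_q-point it would vanish on all F_q-lines, each time to
   order divisible by [q]; the [q^2] lines [x = a y + b z] alone exceed its degree. *)
Lemma SLinvariant_nonvanishing F : F != 0 -> F \is (q ^ 3 - q ^ 2).-homog ->
  SLinvariant F -> ev0 0 1 0 F != 0.
Proof.
move=> F0 hF inv; rewrite -line_polyE; apply/negP => /eqP e0.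
set n := (q ^ 3 - q ^ 2)%N in hF.
have en : n = (q ^ 2 * q.-1)%N by rewrite /n !expnS expn0 -subn1; nia.
have n0 : (0 < n)%N by rewrite en muln_gt0 expn_gt0 q_gt0 -ltnS prednK.
have l0 : line_poly 1 0 F = 0.
  apply/eqP/negPn/negP => l0.
  have := SLinvariant_degree n0 hF inv l0; rewrite e0 eqxx => -[[]//|[_]].
  by rewrite en; rewrite cubeB_factor // -{2}[q]expn1; nia.
have [k [G [eG nd]]] := strip_z F0.
have k0 : (0 < k)%N.
  rewrite lt0n; apply/negP => /eqP k0; apply: nd.
  by rewrite eG k0 expr0 mul1r in hF l0; apply: line_poly_eq0_rdvd hF l0.
have FG0 : G * 'X_i2 ^+ k != 0 by rewrite mulrC -eG.
have hFG : G * 'X_i2 ^+ k \is n.-homog by rewrite mulrC -eG.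
have [d [dn hG hX]] := homog_factor FG0 hFG.
have Xk0 : 'X_i2 ^+ k != 0 :> {mpoly K[3]}.
  by rewrite expf_neq0 //; case: (@mpolyX_irreducible K 3 i2).
have ek : (n - d)%N = k.
  apply: (dhomog_uniq Xk0 hX).
  have := @dhomogMn 3 K mdeg 1 'X_i2 k; rewrite mul1n; apply.
  by rewrite dhomogX; apply/eqP; exact: mdeg1.
have invG i j (a : K) : i != j -> j != i2 -> a ^+ q = a -> act (transvection i j a) G = G.
  move=> ij j2 aq; apply: (@act_cancel_X i j a k i2); first by rewrite eq_sym.
  by rewrite -eG inv.
(* Both n and the degree d of the cofactor are multiples of q, hence so is the order k = n - d along
   z = 0. *)
have qd : (q %| d)%N.
  apply: (dvdn_degree_of_line hG) => [b bq|b bq|b bq|]; try exact: invG.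
  by apply: contra_notN nd => /eqP lG; apply: line_poly_eq0_rdvd hG lG.
have qk : (q %| k)%N.
  by rewrite -ek dvdn_subr // en -mulnA mulnC -mulnA dvdn_mulr.
have qlek : (q <= k)%N by apply: dvdn_leq.
have eF : F = 'X_i2 ^+ q * ('X_i2 ^+ (k - q) * G) by rewrite mulrA -exprD subnKC.
set H := _ * G in eF.
(* Where [D] does not vanish, y and z are linearly independent over F_q, so the q^2 values a y + b z
   are distinct. *)
pose D : {mpoly K[3]} := 'X_i1 ^+ q * 'X_i2 - 'X_i1 * 'X_i2 ^+ q.
have D0 : D != 0.
  have : 'X^q - 'X != 0 :> {poly K}.
    rewrite -size_poly_eq0 size_polyDl ?size_polyXn //.
    by rewrite size_polyN size_polyX ltnS.
  case/closed_nonrootP => y; rewrite /root !hornerE => yq.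
  apply: contraNneq yq => D0; have := congr1 (ev0 0 y 1) D0.
  by rewrite rmorphB !rmorphM !rmorphXn rmorph0 /= /ev0 !evX /coords /= !expr1n !mulr1 => ->.
have [v] := mpoly_neq0_meval (mulf_neq0 F0 D0); rewrite mevalM mulf_eq0 negb_or.
rewrite -!ev0_coords; move: (v i0) (v i1) (v i2) => x1 y1 z1 /andP[Fv].
rewrite /D rmorphB !rmorphM !rmorphXn /= /ev0 !evX /coords /= => Dv.
set g := line_poly y1 z1 F.
have g0 : g != 0.
  by apply: contraNneq Fv => g0; have := line_polyE y1 z1 F x1; rewrite -/g g0 horner0 => <-.
have [fq [ufq sfq mfq _]] := Fq_seq p_pr h_gt0 pcharK.
have Fqval a : a \in fq -> a ^+ q = a by rewrite mfq => /eqP.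
pose S := [seq a * y1 + b * z1 | a <- fq, b <- fq].
have uS : uniq S.
  apply: allpairs_uniq => // -[a b] [c d'] /allpairsP[[a1 b1] /= [/Fqval aq /Fqval bq [-> ->]]].
  move=> /allpairsP[[c1 d1] /= [/Fqval cq /Fqval dq [-> ->]]] /= E.
  have subq (u w : K) : u ^+ q = u -> w ^+ q = w -> (u - w) ^+ q = u - w.
    by move=> uq wq; rewrite /q (frobB p_pr pcharK) -/q uq wq.
  have E1 : (a1 - c1) * y1 = (d1 - b1) * z1.
    by apply/eqP; rewrite -subr_eq0; apply/eqP; rewrite -(subrr (a1 * y1 + b1 * z1)) {2}E; ring.
  have E2 : (a1 - c1) * y1 ^+ q = (d1 - b1) * z1 ^+ q.
    by rewrite -{1}(subq _ _ aq cq) -{1}(subq _ _ dq bq) -!exprMn E1.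
  have Z1 : (a1 - c1) * (y1 ^+ q * z1 - y1 * z1 ^+ q) = 0.
    by rewrite mulrBr !mulrA E2 E1; ring.
  have Z2 : (d1 - b1) * (y1 ^+ q * z1 - y1 * z1 ^+ q) = 0.
    have -> : (d1 - b1) * (y1 ^+ q * z1 - y1 * z1 ^+ q) =
      (d1 - b1) * z1 * y1 ^+ q - y1 * ((d1 - b1) * z1 ^+ q) by ring.
    by rewrite -E1 -E2; ring.
  move/eqP: Z1; rewrite mulf_eq0 (negbTE Dv) orbF subr_eq0 => /eqP ->.
  by move/eqP: Z2; rewrite mulf_eq0 (negbTE Dv) orbF subr_eq0 => /eqP ->.
have : (size S * q < size g)%N.
  apply: leq_roots_exp_size => // _ /allpairsP[[a b] /= [/Fqval aq /Fqval bq ->]].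
  (* Two transvections and a swap carry the line x = a y + b z to z = 0, turning the factor z^q of
     [F] into (-x')^q. *)
  pose x' : {poly K} := 'X + (- a)%:P * y1%:P + (- b)%:P * z1%:P.
  have ex' : x' = 'X - (a * y1 + b * z1)%:P.
    by rewrite /x' !polyCN polyCD !polyCM; ring.
  have -> : g = ev (@polyC K) x' y1%:P z1%:P F.
    rewrite /x' -ev_trv_zx inv //; last exact: FqN.
    by rewrite -ev_trv_yx inv //; apply: FqN.
  rewrite -(swap_xz (@polyC K) _ _ _ (inv i2 i0 ^~ isT) (inv i0 i2 ^~ isT) Fq1 (oner_neq0 _)).
  rewrite eF rmorphM rmorphXn /= evX /coords /= -ex'.
  apply: dvdp_mulr; rewrite invr1 polyC1 mulN1r.
  by apply/dvdpP; exists ((-1) ^+ q); rewrite -exprMn mulN1r.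
have sg : (size g <= n.+1)%N := size_line_poly y1 z1 hF.
rewrite size_allpairs sfq => lt; have := leq_trans lt sg.
rewrite ltnS en; have -> : (p ^ h)%N = q by []. 
rewrite !expnS expn0 muln1 -subn1 => le.
have : (q * q * q <= q * q * (q - 1))%N by [].
by rewrite leq_pmul2l ?muln_gt0 ?q_gt0 // leqNgt ltn_subrL q_gt0.
Qed.

End SLInvariants.

(** * Dickson invariants *)

Section DicksonPolynomials.
Variable q : nat.

Section Defs.
Variable R : comNzRingType.
Implicit Types x y z : R.

(** The 2 x 2 Moore determinant: up to a scalar, the product of the linear forms over F_q in x and
    y, one for each point of the projective line. *)
Definition moore2 x y := x ^+ q * y - x * y ^+ q.

(** The Dickson invariant of degree q^2 - q in two variables: the quotient of x^(q^2) y - x y^(q^2)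
    by [moore2 x y], summed as a geometric series. *)
Definition dickson2 x y := \sum_(i < q.+1) (x ^+ q.-1) ^+ (q - i) * (y ^+ q.-1) ^+ i.

(* The product of all [z - a x - b y] with [a, b] in F_q. *)
Definition qspan_poly x y z :=
  z ^+ (q ^ 2) - dickson2 x y * z ^+ q + moore2 x y ^+ q.-1 * z.

(* The Dickson invariants of degrees [q^3 - q^2] and [q^3 - q], written as
   polynomials in [qspan_poly]. *)
Definition dickson32 x y z := dickson2 x y ^+ q + qspan_poly x y z ^+ q.-1.
Definition dickson31 x y z :=
  moore2 x y ^+ (q * q.-1) + qspan_poly x y z ^+ q.-1 * dickson2 x y.

(** Expanded along the last column, so that Moore determinants appear as polynomials in z. *)
Definition det3 (r s t : R * R * R) : R :=
  r.2 * (s.1.1 * t.1.2 - s.1.2 * t.1.1) - s.2 * (r.1.1 * t.1.2 - r.1.2 * t.1.1)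
  + t.2 * (r.1.1 * s.1.2 - r.1.2 * s.1.1).

Definition moore3 (i j k : nat) x y z :=
  let row m := (x ^+ (q ^ m), y ^+ (q ^ m), z ^+ (q ^ m)) in det3 (row i) (row j) (row k).
End Defs.

Section Morphisms.
Variables (R S : comNzRingType) (f : {rmorphism R -> S}).

Lemma rmorph_moore2 x y : f (moore2 x y) = moore2 (f x) (f y).
Proof. by rewrite /moore2 rmorphB !rmorphM !rmorphXn. Qed.

Lemma rmorph_dickson2 x y : f (dickson2 x y) = dickson2 (f x) (f y).
Proof. by rewrite rmorph_sum; apply: eq_bigr => i _; rewrite rmorphM !rmorphXn. Qed.

Lemma rmorph_qspan_poly x y z : f (qspan_poly x y z) = qspan_poly (f x) (f y) (f z).
Proof.
by rewrite /qspan_poly rmorphD rmorphB !rmorphM !rmorphXn rmorph_moore2 rmorph_dickson2.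
Qed.

Lemma rmorph_dickson32 x y z : f (dickson32 x y z) = dickson32 (f x) (f y) (f z).
Proof. by rewrite /dickson32 rmorphD !rmorphXn rmorph_qspan_poly rmorph_dickson2. Qed.

Lemma rmorph_dickson31 x y z : f (dickson31 x y z) = dickson31 (f x) (f y) (f z).
Proof.
by rewrite /dickson31 rmorphD rmorphM !rmorphXn rmorph_qspan_poly rmorph_dickson2 rmorph_moore2.
Qed.
End Morphisms.

Section Scaling.
Variable R : comNzRingType.
Hypothesis q0 : (0 < q)%N.
Implicit Types c x y z : R.

Lemma moore2_scale c x y : moore2 (c * x) (c * y) = c ^+ q.+1 * moore2 x y.
Proof. by rewrite /moore2 !exprMn exprS; ring. Qed.

Lemma dickson2_scale c x y : dickson2 (c * x) (c * y) = c ^+ (q.-1 * q) * dickson2 x y.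
Proof.
rewrite /dickson2 big_distrr; apply: eq_bigr => i _ /=; rewrite !exprMn.
by rewrite mulrACA -exprD subnK -1?ltnS // exprM.
Qed.

Lemma qspan_poly_scale c x y z :
  qspan_poly (c * x) (c * y) (c * z) = c ^+ (q ^ 2) * qspan_poly x y z.
Proof.
rewrite /qspan_poly dickson2_scale moore2_scale !exprMn -exprM.
have -> : c ^+ (q ^ 2) = c ^+ (q.-1 * q) * c ^+ q.
  by rewrite -exprD; congr (_ ^+ _); rewrite -{3}(prednK q0); nia.
have E : c ^+ (q.-1 * q) * c ^+ q = c ^+ (q.+1 * q.-1) * c.
  by rewrite -exprD -exprSr; congr (_ ^+ _); nia.
have -> : c ^+ (q.+1 * q.-1) * moore2 x y ^+ q.-1 * (c * z) =
   (c ^+ (q.+1 * q.-1) * c) * (moore2 x y ^+ q.-1 * z) by ring.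
by rewrite -E; ring.
Qed.

Lemma dickson32_scale c x y z :
  dickson32 (c * x) (c * y) (c * z) = c ^+ (q ^ 3 - q ^ 2) * dickson32 x y z.
Proof.
rewrite /dickson32 qspan_poly_scale dickson2_scale !exprMn -!exprM.
have -> : (q.-1 * q * q = q ^ 3 - q ^ 2)%N by rewrite !expnS expn0 -subn1; nia.
have -> : (q ^ 2 * q.-1 = q ^ 3 - q ^ 2)%N by rewrite !expnS expn0 -subn1; nia.
by rewrite mulrDr.
Qed.

Lemma dickson31_scale c x y z :
  dickson31 (c * x) (c * y) (c * z) = c ^+ (q ^ 3 - q) * dickson31 x y z.
Proof.
rewrite /dickson31 qspan_poly_scale dickson2_scale moore2_scale !exprMn -!exprM.
have -> : (q.+1 * (q * q.-1) = q ^ 3 - q)%N by rewrite cubeB_factor.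
have -> : c ^+ (q ^ 2 * q.-1) * qspan_poly x y z ^+ q.-1 * (c ^+ (q.-1 * q) * dickson2 x y) =
  c ^+ (q ^ 2 * q.-1) * c ^+ (q.-1 * q) * (qspan_poly x y z ^+ q.-1 * dickson2 x y) by ring.
rewrite -exprD.
have -> : (q ^ 2 * q.-1 + q.-1 * q = q ^ 3 - q)%N by rewrite cubeB_factor // !expnS expn0; nia.
by rewrite mulrDr.
Qed.

End Scaling.

Lemma moore2_dickson2 (R : comNzRingType) (x y : R) : (0 < q)%N ->
  moore2 x y * dickson2 x y = x ^+ (q ^ 2) * y - x * y ^+ (q ^ 2).
Proof.
move=> q0.
have -> : moore2 x y = x * y * (x ^+ q.-1 - y ^+ q.-1).
  by rewrite /moore2 -(prednK q0) /= !exprS; ring.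
rewrite -mulrA /dickson2.
have := subrXX (x ^+ q.-1) (y ^+ q.-1) q.+1; rewrite /= => <-; rewrite -!exprM.
have -> : (q ^ 2 = (q.-1 * q.+1).+1)%N by rewrite -{1}(prednK q0) !expnS expn0; nia.
by rewrite !exprS; ring.
Qed.

End DicksonPolynomials.

Section MooreIdentities.
Variables (p h : nat).
Hypotheses (p_pr : prime p) (h_gt0 : (0 < h)%N).
Let q := (p ^ h)%N.
Let q0 : (0 < q)%N := ltnW (q_gt1 p_pr h_gt0).
Variable R : idomainType.
Hypothesis charR : p \in [pchar R].
Variables x y z : R.

Let FB (a b : R) : (a - b) ^+ q = a ^+ q - b ^+ q := frobB p_pr charR a b h.
Let FD (a b : R) : (a + b) ^+ q = a ^+ q + b ^+ q := frobD p_pr charR a b h.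
Let X1 (a : R) : a ^+ (q ^ 1) = a ^+ q. Proof. by rewrite expn1. Qed.
Let XS (a : R) k : (a ^+ (q ^ k)) ^+ q = a ^+ (q ^ k.+1).
Proof. by rewrite -exprM -expnSr. Qed.

Let l := moore2 q x y.
Let d := dickson2 q x y.
Let e := l ^+ q.-1.
Let w := qspan_poly q x y z.

Let el : e * l = l ^+ q. Proof. by rewrite -exprSr prednK. Qed.

Let lq k : l ^+ (q ^ k) =
  x ^+ (q ^ k.+1) * y ^+ (q ^ k) - x ^+ (q ^ k) * y ^+ (q ^ k.+1).
Proof.
elim: k => [|k IHk]; first by rewrite expn0 !expr1 !X1.
by rewrite -[LHS]XS IHk FB !exprMn !XS.
Qed.

Let ld : l * d = x ^+ (q ^ 2) * y - x * y ^+ (q ^ 2).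
Proof. exact: moore2_dickson2. Qed.

Let lqD : l ^+ q * d ^+ q = x ^+ (q ^ 3) * y ^+ q - x ^+ q * y ^+ (q ^ 3).
Proof. by rewrite -exprMn ld FB !exprMn !XS. Qed.

Lemma moore3_qspan : moore3 q 2 1 0 x y z = w * l.
Proof.
rewrite /moore3 /det3 /= /w /qspan_poly -/l -/d -/e !expn0 !expr1 !X1.
have := lq 1; rewrite !X1 -el => E1.
have -> : (z ^+ (q ^ 2) - d * z ^+ q + e * z) * l =
   z ^+ (q ^ 2) * l - z ^+ q * (l * d) + z * (e * l) by ring.
by rewrite E1 ld /l /moore2; ring.
Qed.

Hypothesis l0 : l != 0.

Let lDe : l * (d ^+ q * d - e ^+ q) = x ^+ (q ^ 3) * y - x * y ^+ (q ^ 3).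
Proof.
have lq0 : l ^+ q != 0 by rewrite expf_neq0.
apply: (mulIf lq0).
have -> : l * (d ^+ q * d - e ^+ q) * l ^+ q =
   (l * d) * (l ^+ q * d ^+ q) - l * (e * l) ^+ q by rewrite exprMn; ring.
rewrite el -exprM mulnn lqD ld (lq 2) -[q in l ^+ q]expn1 (lq 1) !X1.
by rewrite /l /moore2; ring.
Qed.

Let wq : w ^+ q = z ^+ (q ^ 3) - d ^+ q * z ^+ (q ^ 2) + e ^+ q * z ^+ q.
Proof. by rewrite /w /qspan_poly -/l -/d -/e FD FB !exprMn XS -exprM mulnn. Qed.

Let ww : w ^+ q.-1 * w = w ^+ q. Proof. by rewrite -exprSr prednK. Qed.

(** Times w, [dickson32] becomes d^q w + w^q, in which the terms in z^(q^2) cancel; this is why the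
    rows 3, 1, 0 remain. *)
Lemma moore3_dickson32 : dickson32 q x y z * moore3 q 2 1 0 x y z = moore3 q 3 1 0 x y z.
Proof.
rewrite moore3_qspan /dickson32 -/d -/w.
have -> : (d ^+ q + w ^+ q.-1) * (w * l) = (d ^+ q * w + w ^+ q.-1 * w) * l by ring.
rewrite ww wq {1}/w /qspan_poly -/l -/d -/e.
have -> : (d ^+ q * (z ^+ (q ^ 2) - d * z ^+ q + e * z) +
   (z ^+ (q ^ 3) - d ^+ q * z ^+ (q ^ 2) + e ^+ q * z ^+ q)) * l =
   z ^+ (q ^ 3) * l - z ^+ q * (l * (d ^+ q * d - e ^+ q)) + z * (d ^+ q * (e * l)) by ring.
rewrite lDe el [d ^+ q * _]mulrC lqD /moore3 /det3 /= !expn0 !expr1 !X1 /l /moore2.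
by ring.
Qed.

(** Times w, [dickson31] becomes e^q w + d w^q, in which the terms in z^q cancel, leaving the rows
    3, 2, 0. *)
Lemma moore3_dickson31 : dickson31 q x y z * moore3 q 2 1 0 x y z = moore3 q 3 2 0 x y z.
Proof.
rewrite moore3_qspan /dickson31 -/d -/w -/l mulnC exprM -/e.
have -> : (e ^+ q + w ^+ q.-1 * d) * (w * l) = (e ^+ q * w + w ^+ q.-1 * w * d) * l by ring.
rewrite ww wq {1}/w /qspan_poly -/l -/d -/e.
have -> : (e ^+ q * (z ^+ (q ^ 2) - d * z ^+ q + e * z) +
   (z ^+ (q ^ 3) - d ^+ q * z ^+ (q ^ 2) + e ^+ q * z ^+ q) * d) * l =
   z ^+ (q ^ 3) * (l * d) - z ^+ (q ^ 2) * (l * (d ^+ q * d - e ^+ q))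
   + z * (e ^+ q * (e * l)) by ring.
rewrite lDe el -exprMn el -exprM mulnn (lq 2) ld /moore3 /det3 /= !expn0 !expr1.
by ring.
Qed.

End MooreIdentities.

Lemma det_mx33 (R : comNzRingType) (M : 'M[R]_3) :
  \det M = det3 (M i0 i0, M i0 i1, M i0 i2) (M i1 i0, M i1 i1, M i1 i2)
                (M i2 i0, M i2 i1, M i2 i2).
Proof.
pose g a b := M (inord a) (inord b).
have F i j : M i j = g (val i) (val j) by rewrite /g !inord_val.
rewrite (expand_det_row _ ord0) !big_ord_recl big_ord0 /cofactor.
do !rewrite (expand_det_row _ ord0) !big_ord_recl big_ord0 /cofactor.
rewrite !det_mx00 !mxE !F /det3 /= /bump /= !addn0 !add0n.
by rewrite !expr0 !expr1 !expr2; ring.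
Qed.

Section DicksonForms.
Variables (K : closedFieldType) (p h : nat).
Hypotheses (p_pr : prime p) (h_gt0 : (0 < h)%N) (pcharK : p \in [pchar K]).
Let q := (p ^ h)%N.
Let q1 : (1 < q)%N := q_gt1 p_pr h_gt0.
Let q0 : (0 < q)%N := ltnW q1.

Definition dickson32_form : {mpoly K[3]} := dickson32 (p ^ h) 'X_i0 'X_i1 'X_i2.
Definition dickson31_form : {mpoly K[3]} := dickson31 (p ^ h) 'X_i0 'X_i1 'X_i2.

Lemma ev_dickson32 (R : comNzRingType) (f : {rmorphism K -> R}) x y z :
  ev f x y z dickson32_form = dickson32 q x y z.
Proof. by rewrite [LHS]rmorph_dickson32 /= !evX. Qed.

Lemma ev_dickson31 (R : comNzRingType) (f : {rmorphism K -> R}) x y z :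
  ev f x y z dickson31_form = dickson31 q x y z.
Proof. by rewrite [LHS]rmorph_dickson31 /= !evX. Qed.

Lemma dickson32_form_homog : dickson32_form \is (q ^ 3 - q ^ 2).-homog.
Proof.
apply: homog_of_scale => c v; rewrite -!ev0_coords /ev0 !ev_dickson32.
exact: dickson32_scale.
Qed.

Lemma dickson31_form_homog : dickson31_form \is (q ^ 3 - q).-homog.
Proof.
apply: homog_of_scale => c v; rewrite -!ev0_coords /ev0 !ev_dickson31.
exact: dickson31_scale.
Qed.

Definition moore_mx i j k (v : 'rV[K]_3) : 'M[K]_3 :=
  \matrix_(r, c) v 0 c ^+ (q ^ nth 0%N [:: i; j; k] r).

Lemma moore_mx_mul i j k (v : 'rV[K]_3) (M : 'M[K]_3) :
  (forall r c, M r c ^+ q = M r c) -> moore_mx i j k (v *m M) = moore_mx i j k v *m M.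
Proof.
move=> Mq; apply/matrixP => r c; rewrite !mxE.
set e := nth _ _ _.
have Mqe (a b : 'I_3) : M a b ^+ (q ^ e) = M a b.
  by elim: (e) => [|e' IHe]; rewrite ?expr1 // expnSr exprM IHe.
rewrite {1}/q -expnM (frobq_sum p_pr pcharK) expnM -/q; apply: eq_bigr => l _.
by rewrite !mxE exprMn Mqe.
Qed.

(** The nonvanishing of [P] defines the dense set on which Moore determinants can be cancelled;
    identities proved there hold everywhere. *)
Lemma moore_nonzero : exists2 P : {mpoly K[3]}, P != 0 & forall v : 'I_3 -> K,
  P.@[v] = qspan_poly q (v i0) (v i1) (v i2) * moore2 q (v i0) (v i1).
Proof.
exists (qspan_poly q 'X_i0 'X_i1 'X_i2 * moore2 q 'X_i0 'X_i1); last first.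
  by move=> v; rewrite mevalM (rmorph_qspan_poly q (meval v)) (rmorph_moore2 q (meval v)) /= !mevalXU.
apply: mulf_neq0.
  have : (1 : K) != 0 := oner_neq0 _; apply: contraNneq => E.
  have := congr1 (ev0 0 0 1) E; rewrite rmorph0 [ev0 _ _ _ _](rmorph_qspan_poly q (ev0 0 0 1)) /=.
  rewrite /ev0 !evX /coords /= /qspan_poly expr1n => <-.
  have -> : dickson2 q 0 0 = 0 :> K.
    rewrite /dickson2 big1 // => i _; rewrite !expr0n.
    have -> : (q.-1 == 0)%N = false by rewrite gtn_eqF // -ltnS prednK.
    case: i => -[|i] //= lt; rewrite ?expr0n ?mulr0 // subn0 gtn_eqF // mul0r //.
  have -> : moore2 q 0 0 = 0 :> K by rewrite /moore2 mulr0 mul0r subrr.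
  rewrite expr0n gtn_eqF ?mul0r ?addr0 ?subr0 //.
  by rewrite -ltnS prednK.
have : 'X^q - 'X != 0 :> {poly K}.
  rewrite -size_poly_eq0 size_polyDl ?size_polyXn //.
  by rewrite size_polyN size_polyX ltnS.
case/closed_nonrootP => x; rewrite /root !hornerE => xq.
apply: contraNneq xq => D0; have := congr1 (ev0 x 1 0) D0.
rewrite rmorph0 [ev0 _ _ _ _](rmorph_moore2 q (ev0 x 1 0)) /=.
by rewrite /ev0 !evX /coords /= /moore2 !expr1n !mulr1 => ->.
Qed.

Lemma det_moore_mx i j k (v : 'rV[K]_3) :
  \det (moore_mx i j k v) = moore3 q i j k (v 0 i0) (v 0 i1) (v 0 i2).
Proof. by rewrite det_mx33 !mxE. Qed.

Lemma inSL3qP (M : 'M[K]_3) : inSL3q q M ->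
  (forall r c, M r c ^+ q = M r c) /\ \det M = 1.
Proof.
case/andP => /forallP Mq /eqP dM; split=> // r c.
by have /forallP/(_ c)/eqP := Mq r.
Qed.

(* A quotient of two Moore determinants of the same shape is SL(3,q)-invariant,
   since the Frobenius powers commute with a matrix over F_q. *)
Lemma SL3q_act_moore_quotient (F : {mpoly K[3]}) i j k (M : 'M[K]_3) :
  (forall x y z, moore2 q x y != 0 ->
     ev0 x y z F * moore3 q 2 1 0 x y z = moore3 q i j k x y z) ->
  inSL3q q M -> act M F = F.
Proof.
move=> FE /inSL3qP[Mq dM]; apply/eqP; rewrite -subr_eq0; apply/eqP.
have [P P0 PE] := moore_nonzero.
have M3 a b c (v : 'rV[K]_3) : \det (moore_mx a b c (v *m M)) = \det (moore_mx a b c v).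
  by rewrite moore_mx_mul // det_mulmx dM mulr1.
have M3E a b c (v : 'rV[K]_3) : moore3 q a b c ((v *m M) 0 i0) ((v *m M) 0 i1) ((v *m M) 0 i2) =
    moore3 q a b c (v 0 i0) (v 0 i1) (v 0 i2) by rewrite -!det_moore_mx M3.
have nz : act M P * P != 0.
  rewrite mulf_neq0 //.
  have [v Pv] := mpoly_neq0_meval P0.
  apply: contraNneq Pv => AP; pose w := (\row_i v i) *m invmx M.
  have := meval_act M P w; rewrite AP meval0 /w mulmxKV; last by rewrite unitmxE dM unitr1.
  by move=> ->; apply/eqP/meval_eq => l; rewrite mxE.
apply: (ev0_eq0_of_dense nz) => v0; rewrite mevalM mulf_eq0 negb_or => /andP[PMv Pv].
pose v : 'rV[K]_3 := \row_i v0 i.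
have ev G : G.@[v0] = G.@[fun i => v 0 i] by apply: meval_eq => l; rewrite mxE.
rewrite ev meval_act PE in PMv; rewrite ev PE in Pv.
rewrite mevalB (ev (act M F)) (ev F) meval_act -!ev0_coords.
move: PMv Pv; rewrite !mulf_eq0 !negb_or => /andP[_ lM] /andP[wv lv].
have D0 : moore3 q 2 1 0 (v 0 i0) (v 0 i1) (v 0 i2) != 0.
  by rewrite (moore3_qspan p_pr h_gt0 pcharK) mulf_neq0.
apply: (mulIf D0); rewrite mul0r mulrBl FE // -(M3E 2 1 0)%N FE // M3E subrr //.
Qed.

Lemma SL3q_act_dickson32 M : inSL3q q M -> act M dickson32_form = dickson32_form.
Proof.
apply: (@SL3q_act_moore_quotient _ 3 1 0) => x y z l0.
by rewrite /ev0 ev_dickson32; apply: moore3_dickson32.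
Qed.

Lemma SL3q_act_dickson31 M : inSL3q q M -> act M dickson31_form = dickson31_form.
Proof.
apply: (@SL3q_act_moore_quotient _ 3 2 0) => x y z l0.
by rewrite /ev0 ev_dickson31; apply: moore3_dickson31.
Qed.

Lemma transvection_inSL3q i j (a : K) : i != j -> a ^+ q = a ->
  inSL3q q (transvection i j a).
Proof.
move=> ij aq; apply/andP; split.
  apply/forallP => r; apply/forallP => c; rewrite /inFq !mxE.
  have [->|rc] := eqVneq r c.
    have -> : (c == i) && (c == j) = false.
      by apply/negP => /andP[/eqP -> /eqP E]; rewrite E eqxx in ij.
    by rewrite mulr0 addr0 expr1n.
  rewrite mulr0n add0r; case: (_ && _); rewrite ?mulr1 ?mulr0 ?aq //.
  by rewrite expr0n gtn_eqF.
apply/eqP; rewrite det_mx33 /transvection !mxE /det3 /=.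
by case: i j ij => -[|[|[|]]] // ? [[|[|[|]]] ?] //= _; rewrite ?mulr0n ?mulr1n; ring.
Qed.

Lemma act_G_invariant (F : {mpoly K[3]}) :
  (forall M, inSL3q q M -> act M F = F) -> G_invariant (inSL3q q) F.
Proof. by move=> H M GM v; rewrite /on_curve -meval_act H. Qed.

Lemma act_SLinvariant (F : {mpoly K[3]}) :
  (forall M, inSL3q q M -> act M F = F) -> SLinvariant p h F.
Proof. by move=> H i j a ij aq; apply/H/transvection_inSL3q. Qed.

(** At z = 1 the Moore determinants with rows 3, 1, 0 and 2, 1, 0 are the numerator and the
    denominator of the DGZ equation. *)
Lemma dickson32_is_DGZ (c : K) : c != 0 -> is_DGZ_curve q (c *: dickson32_form).
Proof.
move=> c0; exists c; split=> //.
have dehomE (F : {mpoly K[3]}) : dehom F = ev (@mpolyC 3 K) (Defs.mX K) (Defs.mY K) 1 F.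
  by rewrite -[LHS]ev_mpolyC_id ev_comp /= !evX /coords /= rmorph1.
rewrite dehomE evZ ev_dickson32 -mul_mpolyC -mulrA; congr (_ * _).
have charR : p \in [pchar {mpoly K[3]}] := rmorph_pchar (@mpolyC 3 K) pcharK.
have l0 : moore2 q (Defs.mX K) (Defs.mY K) != 0.
  have [P P0 PE] := moore_nonzero; apply: contraNneq P0 => l0; apply/eqP.
  apply: mpoly_eq0_of_meval => v; rewrite PE.
  have := congr1 (meval v) l0; rewrite (rmorph_moore2 q (meval v)) /= !mevalXU meval0 => ->.
  by rewrite mulr0.
have := moore3_dickson32 p_pr h_gt0 charR 1 l0.
have -> : moore3 q 2 1 0 (Defs.mX K) (Defs.mY K) 1 = DGZ_den K q.
  by rewrite /moore3 /det3 /DGZ_den /= !expr1n !expn0 !expr1 expn1; ring.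
have -> : moore3 q 3 1 0 (Defs.mX K) (Defs.mY K) 1 = DGZ_num K q.
  by rewrite /moore3 /det3 /DGZ_num /= !expr1n !expn0 !expr1 expn1; ring.
by [].
Qed.

End DicksonForms.

(** * Irreducible factors of the Dickson invariants *)

Lemma irreducible_automorphism (R : idomainType) (phi psi : {rmorphism R -> R}) (a : R) :
  cancel phi psi -> cancel psi phi -> irreducible_elt a -> irreducible_elt (phi a).
Proof.
move=> phiK psiK [a0 nu irr]; split.
- by apply: contraNneq a0 => e; rewrite -[a]phiK e rmorph0.
- by apply: contra nu => /(rmorph_unit psi); rewrite phiK.
- move=> b c e; have [|ub|uc] := irr (psi b) (psi c).
  + by rewrite -rmorphM -e phiK.
  + by left; rewrite -[b]psiK rmorph_unit.
  + by right; rewrite -[c]psiK rmorph_unit.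
Qed.

(** The multiplier [u] remains a visible factor of every iterate, so it is a unit once some iterate
    of [phi] is the identity. *)
Lemma rdvd_iter_quotient (R : idomainType) (phi : {rmorphism R -> R}) (a u : R) k :
  phi a = u * a -> exists g, iter k.+1 phi a = (g * u) * a.
Proof.
move=> e; elim: k => [|k [g IHk]]; first by exists 1; rewrite mul1r.
by exists (phi (g * u)); rewrite iterS IHk rmorphM e mulrA.
Qed.

(** * Transvections and cyclic permutations acting on irreducible factors *)

Section Action.
Variables (K : closedFieldType) (p h : nat).
Hypotheses (p_pr : prime p) (h_gt0 : (0 < h)%N) (pcharK : p \in [pchar K]).
Let q := (p ^ h)%N.
Implicit Types (F A B C : {mpoly K[3]}) (M N : 'M[K]_3).

Lemma act_comp M N F : act M (act N F) = act (M *m N) F.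
Proof.
apply: mpoly_eq_of_meval => v.
have ev G : G.@[v] = G.@[fun i => (\row_i v i) 0 i] by apply: meval_eq => l; rewrite mxE.
rewrite (ev (act M (act N F))) (ev (act (M *m N) F)) (meval_act M) (meval_act N).
by rewrite (meval_act (M *m N)) mulmxA.
Qed.

Lemma act1 F : act 1%:M F = F.
Proof.
apply: mpoly_eq_of_meval => v.
have ev G : G.@[v] = G.@[fun i => (\row_i v i) 0 i] by apply: meval_eq => l; rewrite mxE.
by rewrite (ev (act _ _)) (ev F) meval_act mulmx1.
Qed.

Lemma act_homog M F n : F \is n.-homog -> act M F \is n.-homog.
Proof.
move=> hF; apply: homog_of_scale => c v.
rewrite -!ev0_coords /ev0 !ev_act /= -(ev_homog _ _ _ _ _ hF).
by congr (ev _ _ _ _ _); ring.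
Qed.

Lemma transvectionD i j (a b : K) : i != j ->
  transvection i j a *m transvection i j b = transvection i j (a + b).
Proof.
move=> ij; rewrite /transvection mulmxDl !mulmxDr !mul1mx mulmx1.
rewrite -scalemxAl -scalemxAr mul_delta_mx_0; last by rewrite eq_sym.
by rewrite !scaler0 addr0 -addrA -scalerDl [b + a]addrC.
Qed.

Lemma transvection0 i j : transvection i j (0 : K) = 1%:M.
Proof. by rewrite /transvection scale0r addr0. Qed.

Lemma act_transvectionK i j (a : K) : i != j ->
  cancel (act (transvection i j a)) (act (transvection i j (- a))).
Proof. by move=> ij F; rewrite act_comp transvectionD // addNr transvection0 act1. Qed.

Lemma act_transvectionVK i j (a : K) : i != j ->
  cancel (act (transvection i j (- a))) (act (transvection i j a)).
Proof. by move=> ij F; rewrite act_comp transvectionD // subrr transvection0 act1. Qed.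

Lemma iter_act_transvection i j (a : K) F k : i != j ->
  iter k (act (transvection i j a)) F = act (transvection i j (a *+ k)) F.
Proof.
move=> ij; elim: k => [|k IHk]; first by rewrite mulr0n transvection0 act1.
by rewrite iterS IHk act_comp (transvectionD _ _ ij) mulrS.
Qed.

(* The multiplier of a transvection on a form is a p-th root of unity, hence 1. *)
Lemma rdvd_act_transvection i j (a : K) F : i != j -> F != 0 ->
  rdvd F (act (transvection i j a) F) -> act (transvection i j a) F = F.
Proof.
move=> ij F0 [u eu]; have [g eg] := rdvd_iter_quotient p.-1 eu.
rewrite prednK ?prime_gt0 // in eg.
have it k : iter p (act (transvection i j a)) k = k.
  by rewrite iter_act_transvection // (mulrn_pchar pcharK) transvection0 act1.
have gu : g * u = 1 by apply: (mulIf F0); rewrite -eg it mul1r.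
have uu : u \is a GRing.unit by apply/unitrP; exists g; split=> //; rewrite mulrC.
have [c c0 ec] : exists2 c, c != 0 & u = c%:MP.
  by apply/msize_poly1P; rewrite -mpoly_unitE.
have itc k : iter k (act (transvection i j a)) F = (c ^+ k) *: F.
  elim: k => [|k IHk]; first by rewrite expr0 scale1r.
  by rewrite iterS IHk actZ eu ec mul_mpolyC scalerA -exprSr.
have cp : c ^+ p = 1.
  have : (c ^+ p - 1) *: F = 0 by rewrite scalerBl scale1r -itc it subrr.
  by rewrite -mul_mpolyC => /eqP; rewrite mulf_eq0 (negbTE F0) orbF mpolyC_eq0 subr_eq0 => /eqP.
have : (c - 1) ^+ (p ^ 1) = 0 by rewrite (frobB p_pr pcharK) expn1 cp expr1n subrr.
move/eqP; rewrite expf_eq0 => /andP[_]; rewrite subr_eq0 => /eqP c1.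
by rewrite eu ec c1 mul1r.
Qed.

(** The image of [A] is a prime divisor of [C], so it divides the cofactor of [A] or [A] itself; in
    the latter case the inverse transvection maps [A] to a multiple of [A], hence fixes it. *)
Lemma transvection_factor i j (a : K) A C : i != j ->
  irreducible_elt A -> act (transvection i j a) C = C -> rdvd A C ->
  act (transvection i j a) A = A \/ exists B, C = B * act (transvection i j a) A * A.
Proof.
move=> ij irrA invC [B eB].
pose t := act (transvection i j a); pose s := act (transvection i j (- a)).
have irrtA : irreducible_elt (t A).
  apply: (irreducible_automorphism (psi := s)) => //.
    exact: act_transvectionK.
  exact: act_transvectionVK.
have : rdvd (t A) (B * A).
  by rewrite -eB -invC eB rmorphM; exists (t B).
case/(euclidean_mpoly irrtA) => [[D eD]|[D eD]].
  by right; exists D; rewrite eB eD.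
left; have A0 : A != 0 by case: irrA.
have sA : s A = A.
  apply: rdvd_act_transvection => //; exists (s D).
  have E : s A = s D * s (t A) by rewrite -rmorphM -eD.
  rewrite [LHS]E; congr (_ * _); exact: act_transvectionK.
by rewrite -{1}sA; apply: act_transvectionVK.
Qed.

(** A 3-cycle is even, so this permutation matrix has determinant 1 in every characteristic without
    a sign correction. *)
Definition cyclic_mx : 'M[K]_3 := \matrix_(i, j) (j == i + 1)%:R.

Lemma delta_cyclic i j : delta_mx i j *m cyclic_mx = cyclic_mx *m delta_mx (i + 1) (j + 1).
Proof.
apply/matrixP => r c; rewrite !mxE (bigD1 j) //= big1 => [|k kj]; last first.
  by rewrite !mxE (negbTE kj) andbF mul0r.
rewrite (bigD1 (r + 1)) //= big1 => [|k kr]; last by rewrite !mxE (negbTE kr) mul0r.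
by rewrite !mxE !eqxx !addr0 andbT mul1r -mulnb natrM (inj_eq (addIr 1)).
Qed.

Lemma transvection_cyclic i j (a : K) :
  transvection i j a *m cyclic_mx = cyclic_mx *m transvection (i + 1) (j + 1) a.
Proof.
rewrite /transvection mulmxDl mulmxDr mul1mx mulmx1; congr (_ + _).
by rewrite -scalemxAl delta_cyclic scalemxAr.
Qed.

Lemma cyclic_mx_inSL3q : inSL3q q cyclic_mx.
Proof.
apply/andP; split.
  apply/forallP => i; apply/forallP => j; rewrite /inFq mxE.
  case: (j == i + 1); rewrite ?mulr1n ?mulr0n ?expr1n // expr0n gtn_eqF //.
  exact: ltnW (q_gt1 p_pr h_gt0).
by apply/eqP; rewrite det_mx33 !mxE /det3 /= ; ring.
Qed.

Lemma cyclic_mx3 : cyclic_mx *m (cyclic_mx *m cyclic_mx) = 1%:M.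
Proof.
have E (B : 'M[K]_3) r c : (cyclic_mx *m B) r c = B (r + 1) c.
  rewrite mxE (bigD1 (r + 1)) //= big1 => [|k kr]; last by rewrite !mxE (negbTE kr) mul0r.
  by rewrite !mxE eqxx mul1r addr0.
apply/matrixP => r c; rewrite !E !mxE; congr (_ %:R).
have -> : r + 1 + 1 + 1 = r by move: (r) => -[[|[|[|//]]] lt]; apply: val_inj.
by rewrite eq_sym.
Qed.

Lemma act_cyclicK : cancel (act cyclic_mx) (act (cyclic_mx *m cyclic_mx)).
Proof. by move=> F; rewrite act_comp -mulmxA cyclic_mx3 act1. Qed.

Lemma act_cyclicVK : cancel (act (cyclic_mx *m cyclic_mx)) (act cyclic_mx).
Proof. by move=> F; rewrite act_comp cyclic_mx3 act1. Qed.

(** The hypothesis ranges over all irreducible factors of [C], because the cyclic permutation may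
    carry [A] to another factor. *)
Lemma cyclic_conjugate C i j : act cyclic_mx C = C ->
  (forall A, irreducible_elt A -> rdvd A C ->
     forall a : K, a ^+ q = a -> act (transvection i j a) A = A) ->
  forall A, irreducible_elt A -> rdvd A C ->
     forall a : K, a ^+ q = a -> act (transvection (i + 1) (j + 1) a) A = A.
Proof.
move=> invC H A irrA [B eB] a aq; apply: (can_inj act_cyclicK).
rewrite act_comp -transvection_cyclic -act_comp; apply: H => //.
  exact: (irreducible_automorphism (psi := act (cyclic_mx *m cyclic_mx)) act_cyclicK act_cyclicVK).
by rewrite -invC eB rmorphM; exists (act cyclic_mx B).
Qed.

End Action.

(** * The tangent cone of [dickson31_form] at an F_q-point *)

Section Factors.
Variables (K : closedFieldType) (p h : nat).
Hypotheses (p_pr : prime p) (h_gt0 : (0 < h)%N) (pcharK : p \in [pchar K]).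
Let q := (p ^ h)%N.
Let q1 : (1 < q)%N := q_gt1 p_pr h_gt0.
Let q0 : (0 < q)%N := ltnW q1.
Implicit Types (F A B C : {mpoly K[3]}).

(** The quotient of X^(q^2) - X by X^q - X: its roots are the elements of F_(q^2) outside F_q. *)
Definition dickson2_poly : {poly K} := dickson2 (p ^ h) 'X 1.
Local Notation delta := dickson2_poly.

Lemma horner_dickson2 (x : K) : delta.[x] = dickson2 q x 1.
Proof.
rewrite -horner_evalE [LHS](rmorph_dickson2 q (horner_eval x)) /=.
by rewrite !horner_evalE hornerX hornerC.
Qed.

Lemma moore_dickson2_poly : ('X^q - 'X) * delta = 'X^(q ^ 2) - 'X.
Proof.
have := @moore2_dickson2 q _ ('X : {poly K}) 1 q0.
by rewrite /moore2 !expr1n !mulr1.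
Qed.

Lemma deriv_Xqn k : (0 < k)%N -> ('X^(q ^ k) - 'X : {poly K})^`() = -1.
Proof.
move=> k0; rewrite derivB derivXn derivX.
have qK : (q ^ k)%:R = 0 :> K.
  by rewrite /q -expnM natrX (pcharf0 pcharK) expr0n gtn_eqF // muln_gt0 h_gt0.
by rewrite -mulr_natr -polyC_natr qK polyC0 mulr0 sub0r.
Qed.

(** Differentiating (X^q - X) delta = X^(q^2) - X at a root of delta gives (t^q - t) delta'(t) =
    -1. *)
Lemma dickson2_poly_root (t : K) : delta.[t] = 0 ->
  t ^+ q - t != 0 /\ delta^`().[t] != 0.
Proof.
move=> dt; have := congr1 (fun P : {poly K} => P^`().[t]) moore_dickson2_poly.
rewrite derivM deriv_Xqn // -[q in 'X^q - 'X]expn1 deriv_Xqn // expn1.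
rewrite !hornerE dt mulr0 add0r => E.
have : (t ^+ q - t) * delta^`().[t] != 0 by rewrite E oppr_eq0 oner_neq0.
by rewrite mulf_eq0 negb_or => /andP.
Qed.

Lemma dickson2_poly_simple (t : K) f g : delta = f * g -> f.[t] = 0 -> g.[t] != 0.
Proof.
move=> e ft; apply/negP => /eqP gt; have dt : delta.[t] = 0 by rewrite e hornerM ft mul0r.
have [_ /negP[]] := dickson2_poly_root dt.
by rewrite e derivM hornerD !hornerM ft gt mulr0 mul0r addr0.
Qed.

Lemma dickson2_poly_neq0 : delta != 0.
Proof.
apply: contraNneq (oner_neq0 K) => d0.
have := congr1 (fun P : {poly K} => P^`().[0]) moore_dickson2_poly.
rewrite d0 mulr0 derivC deriv_Xqn // !hornerE => /esym/eqP.
by rewrite oppr_eq0.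
Qed.

Lemma dickson2_poly_has_root : exists t, delta.[t] = 0.
Proof.
have /closed_rootP[t /rootP rt] : size delta != 1%N; last by exists t.
apply/negP => /eqP sd.
have := congr1 (fun P : {poly K} => size P) moore_dickson2_poly.
have szl k : (0 < k)%N -> size ('X^(q ^ k) - 'X : {poly K}) = (q ^ k).+1.
  move=> k0; rewrite size_polyDl ?size_polyXn // size_polyN size_polyX ltnS.
  by apply: (leq_trans q1); rewrite -{1}[q]expn1 leq_exp2l.
have l0 : 'X^q - 'X != 0 :> {poly K} by rewrite -size_poly_eq0 -[q]expn1 szl.
rewrite (size_mul l0 dickson2_poly_neq0) sd addn1 /= -[q in 'X^q - 'X]expn1 !szl // => -[E].
by have : (q ^ 1 < q ^ 2)%N; [rewrite ltn_exp2l | rewrite E ltnn].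
Qed.

Let iota : {rmorphism K -> {poly {poly K}}} := polyC \o polyC.

(** F(X, 1, Z) as a polynomial in Z over K[X]. For a form, the leading coefficient in Z is the
    dehomogenised tangent cone at (0 : 0 : 1). *)
Definition zexp F : {poly {poly K}} := ev (polyC \o @polyC K) ('X)%:P 1 'X F.

HB.instance Definition _ :=
  GRing.RMorphism.copy zexp (ev (polyC \o @polyC K) ('X)%:P 1 'X).

Lemma zexp_shift i (a : K) : i != i2 ->
  exists lam, forall F, zexp (act (transvection i i2 a) F) = zexp F \Po ('X + lam%:P).
Proof.
move=> ii; have [lam H] : exists lam : {poly K}, forall F,
    zexp (act (transvection i i2 a) F) = ev iota ('X)%:P 1 ('X + lam%:P) F.
  case: i ii => -[|[|[|//]]] lt // _; rewrite (bool_irrelevance lt isT).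
    exists (a%:P * 'X) => F; rewrite /zexp ev_trv_xz; congr ev.
    by rewrite addrC /iota /= polyCM.
  exists a%:P => F; rewrite /zexp ev_trv_yz; congr ev.
  by rewrite addrC mulr1.
exists lam => F; rewrite H /zexp.
rewrite [RHS](@ev_morph _ _ _ iota iota (comp_poly ('X + lam%:P))) => [|c]; last first.
  by rewrite /= comp_polyC.
by rewrite /= comp_polyC comp_polyX rmorph1.
Qed.

Let l : {poly K} := 'X^q - 'X.

Lemma zexp_dickson31 : exists2 w : {poly {poly K}}, (size (w ^+ q.-1) > 1)%N /\ w \is monic &
  zexp (dickson31_form K p h) = (l ^+ (q * q.-1))%:P + w ^+ q.-1 * delta%:P.
Proof.
pose w : {poly {poly K}} := qspan_poly q ('X)%:P 1 'X.
have dE : dickson2 q ('X : {poly K})%:P 1 = delta%:P.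
  by rewrite /dickson2_poly (rmorph_dickson2 q (@polyC {poly K})) /= polyC1.
have lE : moore2 q ('X : {poly K})%:P 1 = l%:P.
  by rewrite /moore2 !expr1n !mulr1 /l polyCB polyC_exp.
have ew : w = 'X^(q ^ 2) + ((l ^+ q.-1)%:P * 'X - delta%:P * 'X^q).
  by rewrite /w /qspan_poly dE lE -polyC_exp; ring.
have sr : (size ((l ^+ q.-1)%:P * 'X - delta%:P * 'X^q : {poly {poly K}})%R < (q ^ 2).+1)%N.
  rewrite (leq_ltn_trans (size_polyD _ _)) // size_polyN gtn_max !mul_polyC.
  rewrite !(leq_ltn_trans (size_scale_leq _ _)) // ?size_polyXn ?size_polyX ltnS.
    by rewrite -[q in (q < _)%N]expn1 ltn_exp2l.
  by rewrite (leq_trans q1) // -{1}[q]expn1 leq_exp2l.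
have mw : w \is monic.
  by rewrite monicE ew lead_coefDl ?size_polyXn // lead_coefXn.
have sw : size w = (q ^ 2).+1 by rewrite ew size_polyDl ?size_polyXn.
exists w; last first.
  by rewrite /zexp ev_dickson31 /dickson31 dE lE polyC_exp.
split=> //; rewrite ltnNge; apply/negP => le.
have := size_exp w q.-1; rewrite sw /=.
have : (0 < q ^ 2 * q.-1)%N by rewrite muln_gt0 expn_gt0 q0 -ltnS prednK.
by move: le; case: (size _) => [|[|//]] _ lt E; rewrite -E in lt.
Qed.

Lemma lead_coef_zexp_dickson31 : lead_coef (zexp (dickson31_form K p h)) = delta.
Proof.
have [w [sw mw] ->] := zexp_dickson31.
rewrite lead_coefDr.
  by rewrite lead_coefM lead_coefC (monicP (monic_exp _ mw)) mul1r.
rewrite mulrC size_Cmul ?dickson2_poly_neq0 //.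
by rewrite (leq_ltn_trans (size_polyC_leq1 _)).
Qed.

Lemma zexp_eq0 F n : F \is n.-homog -> zexp F = 0 -> F = 0.
Proof.
move=> hF z0; have P0 : 'X_i1 != 0 :> {mpoly K[3]} by case: (@mpolyX_irreducible K 3 i1).
apply: (ev0_eq0_of_dense P0) => v; rewrite mevalXU => v1.
have ev1 x z : ev0 x 1 z F = 0.
  have [phi phiX phiC] : exists2 phi : {rmorphism {poly {poly K}} -> K},
      phi 'X = z & forall P : {poly K}, phi P%:P = P.[x].
    exists (horner_eval x \o horner_eval z%:P).
      by rewrite /= !horner_evalE hornerX hornerC.
    by move=> P; rewrite /= !horner_evalE hornerC.
  have := congr1 phi z0; rewrite rmorph0 /zexp (@ev_morph _ _ _ _ idfun phi) => [|c].
    by rewrite phiX phiC rmorph1 hornerX.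
  by rewrite /= phiC hornerC.
rewrite -ev0_coords -[v i0](divfK v1) -[v i2](divfK v1) -[X in ev0 _ X]mulr1.
by rewrite ![_ / _ * _]mulrC (ev0_homog _ _ _ _ hF) ev1 mulr0.
Qed.

(* At an F_q-point the form [dickson31_form] has the separable tangent cone [delta]:
   the leading coefficient in [z]. Transvections with that centre preserve leading
   coefficients, so they cannot permute irreducible factors nontrivially. *)
Lemma dickson31_factor_fixed A i (a : K) m : i != i2 -> a ^+ q = a ->
  irreducible_elt A -> A \is m.-homog -> rdvd A (dickson31_form K p h) ->
  act (transvection i i2 a) A = A.
Proof.
move=> ii aq irrA hA dA; set C := dickson31_form K p h in dA.
have invC : act (transvection i i2 a) C = C.
  by apply/(SL3q_act_dickson31 p_pr h_gt0 pcharK)/(transvection_inSL3q p_pr h_gt0).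
have [//|[B eB]] := transvection_factor p_pr pcharK ii irrA invC dA.
have [lam Hlam] := zexp_shift a ii.
have eE : zexp C = zexp B * (zexp A \Po ('X + lam%:P)) * zexp A.
  have zM F G : zexp (F * G) = zexp F * zexp G := rmorphM zexp F G.
  by rewrite eB !zM Hlam.
pose al := lead_coef (zexp A).
have eD : delta = lead_coef (zexp B) * al * al.
  rewrite -lead_coef_zexp_dickson31 -/C eE !lead_coefM lead_coef_comp ?size_XaddC //.
  by rewrite lead_coefXaddC expr1n mulr1.
have [t dt] := dickson2_poly_has_root.
have alt : al.[t] != 0.
  apply/negP => /eqP at0.
  have ft : (lead_coef (zexp B) * al).[t] = 0 by rewrite hornerM at0 mulr0.
  by have := dickson2_poly_simple eD ft; rewrite at0 eqxx.
have [lt0 _] := dickson2_poly_root dt.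
pose ht : {rmorphism {poly K} -> K} := horner_eval t.
(* At a root t of delta, [zexp C] becomes a nonzero constant while [zexp A] keeps its degree in Z,
   as [al] does not vanish at t. So [A] does not involve z and no shift of z moves it. *)
have sA : (size (zexp A) <= 1)%N.
  have -> : size (zexp A) = size (map_poly ht (zexp A)).
    by rewrite size_map_poly_id0 //.
  have : map_poly ht (zexp A) %| (l.[t] ^+ (q * q.-1))%:P.
    have -> : (l.[t] ^+ (q * q.-1))%:P = map_poly ht (zexp C).
      have [w _ ->] := zexp_dickson31.
      rewrite rmorphD rmorphM /= !map_polyC /= /ht /= !horner_evalE dt polyC0 mulr0 addr0.
      by rewrite horner_exp.
    by rewrite eE rmorphM /= dvdp_mull.
  have l0 : (l.[t] ^+ (q * q.-1))%:P != 0.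
    by rewrite polyC_eq0 expf_neq0 // /l !hornerE.
  by move/(dvdp_leq l0) => le; rewrite (leq_trans le) // size_polyC_leq1.
apply/eqP; rewrite -subr_eq0; apply/eqP.
apply: (@zexp_eq0 _ m); first by rewrite rpredB // act_homog.
have zB F G : zexp (F - G) = zexp F - zexp G := rmorphB zexp F G.
rewrite zB Hlam (size1_polyC sA) comp_polyC subrr //.
Qed.

End Factors.

(** * Branches of [dickson32_form] on the line z = 0 *)

Lemma polyX_order (R : idomainType) (P : {poly R}) : P != 0 ->
  exists n Q, P = Q * 'X^n /\ Q.[0] != 0.
Proof.
have [k] := ubnP (size P); elim: k P => // k IHk P leP P0.
have [r0|nr] := eqVneq P.[0] 0; last by exists 0%N, P; rewrite expr0 mulr1.
have [Q eQ] : exists Q, P = Q * 'X.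
  have /factor_theorem[Q eQ] : root P 0 by apply/eqP.
  by exists Q; rewrite eQ subr0.
have Q0 : Q != 0 by apply: contraNneq P0 => Q0; rewrite eQ Q0 mul0r.
have [|n [Q' [e n0]]] := IHk Q _ Q0; first by move: leP; rewrite eQ size_mulX.
by exists n.+1, Q'; rewrite eQ {1}e exprSr mulrA.
Qed.

Lemma polyX_order_leq (R : idomainType) (P G : {poly R}) n N :
  P.[0] != 0 -> P * 'X^n = G * 'X^N -> (N <= n)%N.
Proof.
move=> P0 e; rewrite leqNgt; apply: contra P0 => lt.
have := congr1 (fun Q : {poly R} => Q`_n) e.
by rewrite !coefMXn ltnn lt subnn horner_coef0 => ->.
Qed.

Lemma dvd_Xn_comp (K : fieldType) (f : {poly K}) k t n : f != 0 -> (0 < k)%N ->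
  'X^n %| f \Po ('X^k + t%:P) -> (n <= k * mup t f)%N.
Proof.
move=> f0 k0; have [i [g]] := multiplicity_XsubC f t; rewrite f0 /= => nr ef.
have -> : mup t f = i by rewrite ef mupMr // mup_XsubCX eqxx.
rewrite ef comp_polyM rmorphXn /= comp_polyB comp_polyX comp_polyC addrK -exprM.
set G := g \Po _.
have G0 : ~~ root G 0 by rewrite /G root_comp !hornerE expr0n gtn_eqF // add0r.
have nz : G * 'X^(k * i) != 0.
  rewrite mulf_neq0 -?size_poly_eq0 ?size_polyXn // size_poly_eq0.
  by apply: contraNneq G0 => ->; rewrite root0.
move=> dX; have : (n <= mup 0 (G * 'X^(k * i)))%N by rewrite mup_geq // subr0.
have := mup_XsubCX (k * i) (0 : K) 0; rewrite polyC0 subr0 eqxx => E.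
by rewrite mupMr // E.
Qed.

Section UnibranchPoints.
Variables (K : closedFieldType) (p h : nat).
Hypotheses (p_pr : prime p) (h_gt0 : (0 < h)%N) (pcharK : p \in [pchar K]).
Let q := (p ^ h)%N.
Let q1 : (1 < q)%N := q_gt1 p_pr h_gt0.
Let q0 : (0 < q)%N := ltnW q1.
Implicit Types (F A B C : {mpoly K[3]}).
Local Notation delta := (dickson2_poly K p h).
Local Notation C32 := (dickson32_form K p h).

Let qm : (0 < q.-1)%N. Proof. by rewrite -ltnS prednK. Qed.

Lemma dickson32_z0 (R : comNzRingType) (x y : R) :
  dickson32 q x y 0 = dickson2 q x y ^+ q.
Proof.
have e0 k : (0 < k)%N -> 0 ^+ k = 0 :> R by move=> k0; rewrite expr0n gtn_eqF.
have e0q2 : 0 ^+ (q ^ 2) = 0 :> R by rewrite e0 // expn_gt0 q0.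
rewrite /dickson32 /qspan_poly e0q2 (e0 q q0) !mulr0 subr0 addr0 (e0 _ qm).
by rewrite addr0.
Qed.

Let P3 := {poly {poly {poly K}}}.
Let iota : {rmorphism K -> P3} := polyC \o (polyC \o polyC).
Let Sv : P3 := (('X)%:P)%:P.
Let Zv : P3 := ('X)%:P.

(* Weights [q - 1] and [q] along the branch [(x - t)^q = c z^(q-1)] at [(t : 1 : 0)]. *)
Let weighted (t : K) F : P3 := ev iota (iota t + Sv * 'X^(q.-1)) 1 (Zv * 'X^q) F.

(** The choices (1, 0) and (0, 1) of (s, z) restrict to the lines z = 0 and x = t of the chart y =
    1; the order on each line times its weight bounds the weighted order from above. *)
Lemma weighted_specialize (s z t : K) : exists phi : {rmorphism P3 -> {poly K}},
  phi 'X = 'X /\ forall F, phi (weighted t F) =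
     ev (@polyC K) (t%:P + s%:P * 'X^(q.-1)) 1 (z%:P * 'X^q) F.
Proof.
have [phi [phiX phiS phiZ phiC]] : exists phi : {rmorphism P3 -> {poly K}},
    [/\ phi 'X = 'X, phi Sv = s%:P, phi Zv = z%:P & forall c, phi (iota c) = c%:P].
  exists (map_poly (horner_eval s \o horner_eval z%:P)); split.
  - by rewrite /= map_polyX.
  - by rewrite /Sv /= map_polyC /= !horner_evalE !hornerE.
  - by rewrite /Zv /= map_polyC /= !horner_evalE !hornerE.
  - by move=> c; rewrite /iota /= map_polyC /= !horner_evalE !hornerE.
exists phi; split=> // F; rewrite /weighted (ev_morph _ _ _ F phiC).
have -> : phi (iota t + Sv * 'X^(q.-1)) = t%:P + s%:P * 'X^(q.-1).
  by rewrite (rmorphD phi) (rmorphM phi) (rmorphXn phi) phiX phiS phiC.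
have -> : phi (Zv * 'X^q) = z%:P * 'X^q.
  by rewrite (rmorphM phi) (rmorphXn phi) phiX phiZ.
by have -> : phi 1 = 1 := rmorph1 phi.
Qed.

(** Both terms have weighted order at least q (q - 1): [dickson2] acquires the factor X^(q-1) from
    delta(t) = 0, and [qspan_poly] the factor X^q from z. *)
Lemma weighted_dickson32 (t : K) : delta.[t] = 0 ->
  exists G, weighted t C32 = G * 'X^(q * q.-1).
Proof.
move=> dt; pose u : P3 := iota t + Sv * 'X^(q.-1); pose v : P3 := Zv * 'X^q.
rewrite /weighted ev_dickson32 /dickson32 -/q -/u -/v.
have [D1 eD1] : exists D1, dickson2 q u 1 = D1 * 'X^(q.-1).
  have /factor_theorem[g eg] : root delta t by apply/eqP.
  have -> : dickson2 q u 1 = (map_poly iota delta).[u].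
    rewrite -horner_evalE [RHS](rmorph_dickson2 q (horner_eval u \o map_poly iota)) /=.
    by rewrite map_polyX rmorph1 !horner_evalE hornerX hornerC.
  exists ((map_poly iota g).[u] * Sv).
  rewrite eg rmorphM rmorphB /= map_polyX map_polyC hornerM hornerXsubC -mulrA.
  by congr (_ * _); rewrite /u addrAC subrr add0r.
have [W1 eW1] : exists W1, qspan_poly q u 1 v = W1 * 'X^q.
  exists ((v ^+ (q ^ 2).-1 - dickson2 q u 1 * v ^+ q.-1 + moore2 q u 1 ^+ q.-1) * Zv).
  rewrite -mulrA -/v /qspan_poly mulrDl mulrBl -mulrA -!exprSr !prednK //.
  by rewrite expn_gt0 q0.
exists (D1 ^+ q + W1 ^+ q.-1); rewrite eD1 eW1 !exprMn -!exprM mulrDl.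
by rewrite [(q.-1 * q)%N]mulnC.
Qed.

(** On z = 0 the form restricts to delta^q with delta separable; this is the endpoint (q, 0) of the
    Newton edge. *)
Lemma mup_line_dickson32 (t : K) : delta.[t] = 0 -> mup t (line_poly 1 0 C32) = q.
Proof.
move=> dt; have -> : line_poly 1 0 C32 = delta ^+ q.
  by rewrite /line_poly ev_dickson32 polyC1 polyC0 dickson32_z0.
have /factor_theorem[g eg] : root delta t by apply/eqP.
have gt : ~~ root g t.
  have eg' : delta = ('X - t%:P) * g by rewrite mulrC.
  by rewrite /root; apply: (dickson2_poly_simple p_pr h_gt0 pcharK eg'); rewrite !hornerE subrr.
rewrite eg exprMn mupMr ?mup_XsubCX ?eqxx //.
by rewrite /root horner_exp expf_neq0.
Qed.

(** At x = t there remains (z^(q^2) + c z)^(q-1) with c nonzero; this is the endpoint (0, q - 1). *)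
Lemma mup_zline_dickson32 (t : K) : delta.[t] = 0 ->
  mup 0 (ev (@polyC K) t%:P 1 'X C32) = q.-1.
Proof.
move=> dt; have [lt0 _] := dickson2_poly_root p_pr h_gt0 pcharK dt.
rewrite ev_dickson32 /dickson32 /qspan_poly.
have -> : dickson2 q t%:P (1 : {poly K}) = 0.
  have := rmorph_dickson2 q (@polyC K) t 1; rewrite /= polyC1 => <-.
  by rewrite -horner_dickson2 dt polyC0.
set c := moore2 _ _ _ ^+ _.
have [c' c0 ec] : exists2 c', c' != 0 & c = c'%:P.
  exists ((t ^+ q - t) ^+ q.-1); first by rewrite expf_neq0.
  by rewrite /c /moore2 !expr1n !mulr1 polyC_exp polyCB polyC_exp.
rewrite expr0n gtn_eqF // add0r mul0r subr0 ec.
have -> : 'X^(q ^ 2) + c'%:P * 'X = ('X^((q ^ 2).-1) + c'%:P) * ('X - 0%:P).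
  by rewrite subr0 mulrDl -exprSr prednK // expn_gt0 q0.
rewrite exprMn mupMr ?mup_XsubCX ?eqxx //.
have q2p : (0 < q ^ 2)%N by rewrite expn_gt0 q0.
have q2 : (1 < q ^ 2)%N by apply: (leq_trans q1); rewrite -{1}[q]expn1 leq_exp2l.
have q21 : (0 < (q ^ 2).-1)%N by rewrite -ltnS (prednK q2p).
by rewrite /root horner_exp expf_neq0 // !hornerE expr0n gtn_eqF ?add0r.
Qed.

(* Two factors through [(t : 1 : 0)] would split the Newton edge from [(q, 0)] to
   [(0, q - 1)], which contains no interior lattice point. *)
Lemma dickson32_unibranch (t : K) A B : delta.[t] = 0 -> C32 = A * B ->
  ev0 t 1 0 A = 0 -> ev0 t 1 0 B != 0.
Proof.
move=> dt eC At; apply/negP => /eqP Bt.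
pose zl F := ev (@polyC K) t%:P 1 'X F.
have lM : line_poly 1 0 C32 = line_poly 1 0 A * line_poly 1 0 B by rewrite eC [LHS]rmorphM.
have zM : zl C32 = zl A * zl B by rewrite eC [LHS]rmorphM.
have wM : weighted t C32 = weighted t A * weighted t B by rewrite eC [LHS]rmorphM.
(* [mup] takes the value 0 at the zero polynomial, so the positive orders just computed exclude that
   the restrictions vanish identically. *)
have mup0 s : mup s (0 : {poly K}) = 0%N.
  by rewrite /mup; case: arg_maxnP => [|i _ _]; rewrite ?expr0 ?dvd1p // -[LHS]/(val i); case: i => i /=; rewrite size_poly0 ltnS leqn0 => /eqP.
have l0 : line_poly 1 0 A * line_poly 1 0 B != 0.
  rewrite -lM; apply: contraTneq q0 => E.
  by rewrite -(mup_line_dickson32 dt) E mup0.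
have z0 : zl A * zl B != 0.
  rewrite -zM; apply: contraTneq qm => E.
  by rewrite -(mup_zline_dickson32 dt) -/(zl _) E mup0.
move: l0 z0; rewrite !mulf_eq0 !negb_or => /andP[lA0 lB0] /andP[zA0 zB0].
have iAB : (mup t (line_poly 1 0 A) + mup t (line_poly 1 0 B) = q)%N.
  by rewrite -mupM // -lM mup_line_dickson32.
have jAB : (mup 0 (zl A) + mup 0 (zl B) = q.-1)%N.
  by rewrite -mupM // -zM mup_zline_dickson32.
have bound F : line_poly 1 0 F != 0 -> zl F != 0 -> exists n Q,
    [/\ weighted t F = Q * 'X^n, Q.[0] != 0, (n <= q.-1 * mup t (line_poly 1 0 F))%N &
      (n <= q * mup 0 (zl F))%N].
  move=> lF zF.
  have [phi1 [phi1X phi1F]] := weighted_specialize 1 0 t.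
  have [phi2 [phi2X phi2F]] := weighted_specialize 0 1 t.
  have E1 : phi1 (weighted t F) = line_poly 1 0 F \Po ('X^(q.-1) + t%:P).
    rewrite phi1F /line_poly (@ev_morph _ _ _ (@polyC K) (@polyC K) (comp_poly ('X^(q.-1) + t%:P))) => [|c].
      by rewrite /= comp_polyX !comp_polyC mul0r mul1r addrC.
    by rewrite /= comp_polyC.
  have E2 : phi2 (weighted t F) = zl F \Po ('X^q + 0%:P).
    rewrite phi2F /zl (@ev_morph _ _ _ (@polyC K) (@polyC K) (comp_poly ('X^q + 0%:P))) => [|c].
      by rewrite /= comp_polyX !comp_polyC mul0r mul1r !addr0 rmorph1.
    by rewrite /= comp_polyC.
  have wF0 : weighted t F != 0.
    apply: contraNneq lF => wF; move: E1; rewrite wF rmorph0 => /esym/eqP.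
    by rewrite comp_poly_eq0 // size_XnaddC.
  have [n [Q [eQ Q0]]] := polyX_order wF0; exists n, Q; split=> //.
    apply: dvd_Xn_comp => //; rewrite -E1 eQ (rmorphM phi1) (rmorphXn phi1) phi1X.
    exact: dvdp_mull.
  apply: dvd_Xn_comp => //; rewrite -E2 eQ (rmorphM phi2) (rmorphXn phi2) phi2X.
  exact: dvdp_mull.
have [nA [QA [eA QA0 leA1 leA2]]] := bound A lA0 zA0.
have [nB [QB [eB QB0 leB1 leB2]]] := bound B lB0 zB0.
have [G eG] := weighted_dickson32 dt.
have nAB : (q * q.-1 <= nA + nB)%N.
  apply: (@polyX_order_leq _ (QA * QB) G); first by rewrite hornerM mulf_neq0.
  by rewrite -eG wM eA eB exprD mulrACA.
have root_mup F : line_poly 1 0 F != 0 -> ev0 t 1 0 F = 0 -> (0 < mup t (line_poly 1 0 F))%N.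
  by move=> F0 Ft; rewrite -XsubC_dvd // dvdp_XsubCl /root line_polyE Ft.
have iA0 := root_mup A lA0 At; have iB0 := root_mup B lB0 Bt.
move: iA0 iB0 iAB jAB leA1 leA2 leB1 leB2.
move: (mup t (line_poly 1 0 A)) (mup t (line_poly 1 0 B)) (mup 0 (zl A)) (mup 0 (zl B)) => iA iB jA jB iA0 iB0 iAB jAB leA1 leA2 leB1 leB2.
(* The upper bounds for nA + nB on either line add up to the lower bound q (q - 1), so all are
   equalities and (q - 1) iA = nA = q jA. Then q divides iA, which leaves nothing for iB. *)
have s1 : (q.-1 * iA + q.-1 * iB = q * q.-1)%N by rewrite -mulnDr iAB mulnC.
have s2 : (q * jA + q * jB = q * q.-1)%N by rewrite -mulnDr jAB.
have e : (q.-1 * iA = q * jA)%N by lia.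
have : (q %| q.-1 * iA)%N by rewrite e dvdn_mulr.
rewrite Gauss_dvdr; last by rewrite -{1}(prednK q0) coprimeSn.
move/(dvdn_leq iA0); rewrite -{1}iAB -{2}[iA]addn0 leq_add2l leqn0 => /eqP iB00.
by rewrite iB00 in iB0.
Qed.

(** The transvection fixes z = 0 pointwise, so [A] and its image pass through the same points of
    that line. As complementary factors they would contradict unibranchness at such a point. *)
Lemma dickson32_factor_fixed A i (a : K) m : i != i2 -> a ^+ q = a ->
  irreducible_elt A -> A \is m.-homog -> rdvd A C32 ->
  act (transvection i2 i a) A = A.
Proof.
move=> ii aq irrA hA dA; have i2i : i2 != i by rewrite eq_sym.
have invC : act (transvection i2 i a) C32 = C32.
  by apply/(SL3q_act_dickson32 p_pr h_gt0 pcharK)/(transvection_inSL3q p_pr h_gt0).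
have [//|[B eB]] := transvection_factor p_pr pcharK i2i irrA invC dA.
have C1 : ev0 1 0 0 C32 != 0.
  rewrite /ev0 ev_dickson32 dickson32_z0.
  have -> : dickson2 q 1 0 = 1 :> K.
    rewrite /dickson2 big_ord_recl subn0 expr0 mulr1 !expr1n big1 ?addr0 // => l _.
    by rewrite [0 ^+ q.-1]expr0n gtn_eqF // expr0n /= mulr0.
  by rewrite expr1n oner_neq0.
have A1 : ev0 1 0 0 A != 0.
  by apply: contraNneq C1 => E; rewrite eB rmorphM /= E mulr0.
have m0 : (0 < m)%N.
  rewrite lt0n; apply/negP => /eqP m0; rewrite m0 in hA.
  by case: irrA => A0 /negP nu _; apply/nu/homog0_unit.
(* If it were a constant c, [A] would restrict to c y^m on z = 0 and vanish at (1 : 0 : 0), which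
   the curve avoids. *)
have sl : size (line_poly 1 0 A) != 1%N.
  apply: contraNneq A1 => sl.
  have [c _ lc] := size_poly1P _ (introT eqP sl).
  have P0 : 'X_i1 != 0 :> {mpoly K[3]} by case: (@mpolyX_irreducible K 3 i1).
  pose G := (A \mPo [tuple 'X_i0; 'X_i1; 0]) - c *: 'X_i1 ^+ m.
  have GE w : G.@[w] = ev0 (w i0) (w i1) 0 A - c * w i1 ^+ m.
    rewrite -[LHS]ev0_coords /ev0 /G rmorphB /= ev_comp evZ rmorphXn /= !evX rmorph0.
    by [].
  have G0 : G = 0.
    apply: (ev0_eq0_of_dense P0) => w; rewrite mevalXU GE => w1.
    by rewrite (ev0_line _ hA w1) lc hornerC mulrC subrr.
  have := GE (coords 1 0 0); rewrite G0 meval0 /coords /= expr0n gtn_eqF // mulr0 subr0.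
  by move=> <-.
have [t /rootP rt] := closed_rootP _ sl; rewrite line_polyE in rt.
have dt : delta.[t] = 0.
  have : ev0 t 1 0 C32 = 0 by rewrite eB rmorphM /= rt mulr0.
  rewrite /ev0 ev_dickson32 dickson32_z0 -horner_dickson2 => /eqP.
  by rewrite expf_eq0 => /andP[_ /eqP].
have eC : C32 = A * (B * act (transvection i2 i a) A) by rewrite {1}eB mulrC.
have := dickson32_unibranch dt eC rt; rewrite rmorphM /=.
have -> : ev0 t 1 0 (act (transvection i2 i a) A) = ev0 t 1 0 A.
  case: i {ii i2i invC eB eC} (ii) => -[|[|[|//]]] lt // _; rewrite (bool_irrelevance lt isT) /ev0.
    by rewrite ev_trv_zx mulr0 addr0.
  by rewrite ev_trv_zy mulr0 addr0.
by rewrite rt mulr0 eqxx.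
Qed.

End UnibranchPoints.

(** * Irreducibility, the degree gap and uniqueness *)

Section Curves.
Variables (K : closedFieldType) (p h : nat).
Hypotheses (p_pr : prime p) (h_gt0 : (0 < h)%N) (pcharK : p \in [pchar K]).
Let q := (p ^ h)%N.
Let q1 : (1 < q)%N := q_gt1 p_pr h_gt0.
Let q0 : (0 < q)%N := ltnW q1.
Implicit Types (F A B C : {mpoly K[3]}).
Local Notation C32 := (dickson32_form K p h).
Local Notation C31 := (dickson31_form K p h).

Lemma homog_unit_degree F n : F \is n.-homog -> F \is a GRing.unit -> n = 0%N.
Proof.
move=> hF; rewrite mpoly_unitE => /msize_poly1P[c c0 e].
have F0 : F != 0 by rewrite e mpolyC_eq0.
apply: (dhomog_uniq F0 hF); apply: homog_of_scale => d v.
by rewrite e !mevalC expr0 mul1r.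
Qed.

(** After q^3 - q^2 its next multiple is 2 (q^3 - q^2), already beyond q^3 - q, so neither
    alternative allows a degree strictly in between. *)
Lemma SLinvariant_degree_geq F n : (0 < n)%N -> F \is n.-homog -> SLinvariant p h F ->
  line_poly 1 0 F != 0 ->
  (q ^ 3 - q ^ 2 <= n)%N /\ ((q ^ 3 - q ^ 2 < n)%N -> (q ^ 3 - q <= n)%N).
Proof.
move=> n0 hF inv l0.
have le : (q ^ 3 - q ^ 2 <= q ^ 3 - q)%N by rewrite leq_sub2l // -{1}[q]expn1 leq_exp2l.
have [[_ /dvdnP[k ek]]|[_ len]] := SLinvariant_degree p_pr h_gt0 pcharK n0 hF inv l0.
- rewrite -/q -cubeB_square in ek; have k0 : (0 < k)%N by move: n0; rewrite ek muln_gt0 => /andP[].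
  split; first by rewrite ek leq_pmull.
  move=> lt; have k1 : (1 < k)%N by move: lt; rewrite ek -{1}[(_ - _)%N]mul1n ltn_mul2r => /andP[].
  apply: (leq_trans (ltnW (ltn_cube_double q1))); rewrite ek leq_mul2r k1 orbT //.
- by split=> //; apply: leq_trans len.
Qed.

Lemma line_poly_factor A B : line_poly 1 0 (A * B) != 0 ->
  line_poly 1 0 A != 0 /\ line_poly 1 0 B != 0.
Proof.
have -> : line_poly 1 0 (A * B) = line_poly 1 0 A * line_poly 1 0 B by apply: rmorphM.
by rewrite mulf_eq0 negb_or => /andP.
Qed.

(** Only one irreducible factor need be known to be invariant: its cofactor inherits invariance by
    cancellation, and both then reach the minimal degree. *)
Lemma irreducible_of_invariant_factors C n : (0 < n)%N -> (n < 2 * (q ^ 3 - q ^ 2))%N ->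
  C \is n.-homog -> SLinvariant p h C -> line_poly 1 0 C != 0 ->
  (forall A, irreducible_elt A -> rdvd A C -> SLinvariant p h A) ->
  irreducible_elt C.
Proof.
move=> n0 ltn hC invC lC H.
have C0 : C != 0 by apply: contraNneq lC => ->; apply/eqP; apply: rmorph0.
split=> //.
  by apply/negP => /(homog_unit_degree hC) e; rewrite e in n0.
move=> b c e; apply: NNPP => /not_or_and[/negP ub /negP uc].
have b0 : b != 0 by apply: contraNneq C0 => b0; rewrite e b0 mul0r.
have [A [irrA [d eb]]] := irreducible_factor (@mpoly_degM K 3) (@mpoly_deg0_unit K 3) b0 ub.
pose B := d * c; have eC : C = B * A by rewrite e eb /B mulrAC.
have A0 : A != 0 by case: irrA.
have [i [li hB hA]] : exists i, [/\ (i <= n)%N, B \is i.-homog & A \is (n - i).-homog].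
  by apply: homog_factor; rewrite -eC.
have invA : SLinvariant p h A by apply: H => //; exists B.
have invB : SLinvariant p h B.
  move=> k l a kl aq; apply: (mulIf A0).
  by have := invC k l a kl aq; rewrite eC rmorphM /= (invA k l a kl aq).
rewrite eC in lC; have [lB lA] := line_poly_factor lC.
have i0 : (0 < i)%N.
  rewrite lt0n; apply/negP => /eqP i0; rewrite i0 in hB.
  have B0 : B != 0 by apply: contraNneq C0 => B0; rewrite eC B0 mul0r.
  have := homog0_unit B0 hB; rewrite /B unitrM => /andP[_ uc'].
  by rewrite uc' in uc.
have i1 : (0 < n - i)%N.
  rewrite lt0n; apply/negP => /eqP i1; rewrite i1 in hA.
  by case: irrA => _ /negP[]; apply: homog0_unit.
have [gB _] := SLinvariant_degree_geq i0 hB invB lB.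
have [gA _] := SLinvariant_degree_geq i1 hA invA lA.
by move: ltn; rewrite ltnNge mul2n -addnn -(subnKC li) leq_add.
Qed.

Lemma line_dickson32_neq0 : line_poly 1 0 C32 != 0.
Proof.
rewrite /line_poly ev_dickson32 polyC1 polyC0 (dickson32_z0 p_pr h_gt0) expf_neq0 //.
exact: (dickson2_poly_neq0 p_pr h_gt0 pcharK).
Qed.

Lemma ev0_dickson32 : ev0 0 1 0 C32 != 0.
Proof.
apply: (SLinvariant_nonvanishing p_pr h_gt0 pcharK).
- by apply: contraNneq line_dickson32_neq0 => ->; apply/eqP; apply: rmorph0.
- exact: dickson32_form_homog.
- by apply: (act_SLinvariant p_pr h_gt0) => M; apply: (SL3q_act_dickson32 p_pr h_gt0 pcharK).
Qed.

Lemma line_dickson31_neq0 : line_poly 1 0 C31 != 0.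
Proof.
rewrite /line_poly ev_dickson31 polyC1 polyC0 /dickson31 -/q.
have qm : (0 < q.-1)%N by rewrite -ltnS prednK.
have e0 k : (0 < k)%N -> 0 ^+ k = 0 :> {poly K} by move=> k0; rewrite expr0n gtn_eqF.
have e0q2 : 0 ^+ (q ^ 2) = 0 :> {poly K} by rewrite e0 // expn_gt0 q0.
rewrite /qspan_poly e0q2 (e0 q q0) !mulr0 subr0 addr0 (e0 _ qm) mul0r addr0.
rewrite expf_neq0 // /moore2 !expr1n !mulr1.
by rewrite -size_poly_eq0 size_polyDl ?size_polyXn // size_polyN size_polyX ltnS.
Qed.

Let fixes C i j := forall A, irreducible_elt A -> rdvd A C ->
  forall a : K, a ^+ q = a -> act (transvection i j a) A = A.

(** The six pairs (i, j) form two orbits under the cyclic shift, and each disjunction offers two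
    members of one orbit: [C32] supplies the transvections with axis z = 0, [C31] those with centre
    (0 : 0 : 1). *)
Lemma SLinvariant_of_fixes C : act (cyclic_mx K) C = C ->
  (fixes C i2 i0 \/ fixes C i1 i2) -> (fixes C i2 i1 \/ fixes C i0 i2) ->
  forall A, irreducible_elt A -> rdvd A C -> SLinvariant p h A.
Proof.
move=> invC H1 H2 A irrA dA.
have next i j k l : i + 1 = k -> j + 1 = l -> fixes C i j -> fixes C k l.
  by move=> <- <- H; apply: cyclic_conjugate invC H.
have e01 : i0 + 1 = i1 by apply: val_inj.
have e12 : i1 + 1 = i2 by apply: val_inj.
have e20 : i2 + 1 = i0 by apply: val_inj.
have f20 : fixes C i2 i0 by case: H1 => H; [exact: H | exact: next _ _ _ _ e12 e20 H].
have f01 := next _ _ _ _ e20 e01 f20; have f12 := next _ _ _ _ e01 e12 f01.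
have f02 : fixes C i0 i2 by case: H2 => H; [exact: next _ _ _ _ e20 e12 H | exact: H].
have f10 := next _ _ _ _ e01 e20 f02; have f21 := next _ _ _ _ e12 e01 f10.
move=> i j a ij aq.
have ord3 (k : 'I_3) : [\/ k = i0, k = i1 | k = i2].
  by case: k => -[|[|[|//]]] lt; [apply: Or31|apply: Or32|apply: Or33]; apply: val_inj.
case: (ord3 i) (ord3 j) ij => -> [] -> // _; [exact: f01|exact: f02|exact: f10|exact: f12|exact: f20|exact: f21].
Qed.

Lemma dickson32_irreducible : irreducible_elt C32.
Proof.
have hC := dickson32_form_homog K p_pr h_gt0.
have inv M := @SL3q_act_dickson32 K p h p_pr h_gt0 pcharK M.
have n0 : (0 < q ^ 3 - q ^ 2)%N by rewrite cubeB_square muln_gt0 expn_gt0 q0 -ltnS prednK.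
have fx i : i != i2 -> fixes C32 i2 i.
  move=> ii A irrA [B eB] a aq.
  have [||m [_ _ hA]] := @homog_factor K B A (q ^ 3 - q ^ 2); rewrite -?eB //.
    by apply: contraNneq line_dickson32_neq0 => ->; apply/eqP; apply: rmorph0.
  by apply: (dickson32_factor_fixed p_pr h_gt0 pcharK ii aq irrA hA); exists B.
apply: (irreducible_of_invariant_factors n0 _ hC).
- by rewrite mul2n -addnn -{1}[(q ^ 3 - q ^ 2)%N]addn0 ltn_add2l.
- exact: act_SLinvariant.
- exact: line_dickson32_neq0.
- apply: SLinvariant_of_fixes; first exact/inv/cyclic_mx_inSL3q.
    by left; apply: fx.
  by left; apply: fx.
Qed.

Lemma dickson31_irreducible : irreducible_elt C31.
Proof.
have hC := dickson31_form_homog K p_pr h_gt0.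
have inv M := @SL3q_act_dickson31 K p h p_pr h_gt0 pcharK M.
have n0 : (0 < q ^ 3 - q)%N.
  have qm : (0 < q.-1)%N by rewrite -ltnS prednK.
  by rewrite cubeB_factor // !muln_gt0 q0 qm.
have fx i : i != i2 -> fixes C31 i i2.
  move=> ii A irrA [B eB] a aq.
  have [||m [_ _ hA]] := @homog_factor K B A (q ^ 3 - q); rewrite -?eB //.
    by apply: contraNneq line_dickson31_neq0 => ->; apply/eqP; apply: rmorph0.
  by apply: (dickson31_factor_fixed p_pr h_gt0 pcharK ii aq irrA hA); exists B.
apply: (irreducible_of_invariant_factors n0 (ltn_cube_double q1) hC).
- exact: act_SLinvariant.
- exact: line_dickson31_neq0.
- apply: SLinvariant_of_fixes; first exact/inv/cyclic_mx_inSL3q.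
    by right; apply: fx.
  by right; apply: fx.
Qed.

Lemma irreducible_mpolyE F : irreducible_mpoly F <-> irreducible_elt F.
Proof.
have unitE (G : {mpoly K[3]}) : G != 0 -> (msize G <= 1)%N = (G \is a GRing.unit).
  by move=> G0; rewrite mpoly_unitE eqn_leq lt0n msize_poly_eq0 G0 andbT.
split=> [[sF H]|[F0 nu H]].
- have F0 : F != 0 by rewrite -msize_poly_eq0 -lt0n ltnW.
  split=> //; first by rewrite -unitE // -ltnNge.
  move=> b c e; have : b * c != 0 by rewrite -e.
  by rewrite mulf_eq0 negb_or => /andP[b0 c0]; rewrite -!unitE //; apply: H.
- split; first by rewrite ltnNge unitE.
  move=> b c e; have : b * c != 0 by rewrite -e.
  by rewrite mulf_eq0 negb_or => /andP[b0 c0]; rewrite !unitE //; apply: H.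
Qed.

(* By the Nullstellensatz an invariant zero set makes the form semi-invariant. *)
Lemma G_invariant_SLinvariant F : irreducible_elt F -> G_invariant (inSL3q q) F ->
  SLinvariant p h F.
Proof.
move=> irrF inv i j a ij aq; apply: (rdvd_act_transvection p_pr pcharK) => //.
  by case: irrF.
apply: irreducible_rdvd_of_zeros => // v Fv.
have ev G : G.@[v] = G.@[fun i => (\row_i v i) 0 i] by apply: meval_eq => l; rewrite mxE.
rewrite ev meval_act; apply/eqP.
have := inv _ (transvection_inSL3q p_pr h_gt0 ij aq) (\row_i v i).
by rewrite /on_curve => ->; rewrite -ev Fv.
Qed.

Lemma line_poly_irreducible F n : (2 <= n)%N -> F \is n.-homog -> irreducible_elt F ->
  line_poly 1 0 F != 0.
Proof.
move=> n2 hF [F0 nu irr]; apply/negP => /eqP /(line_poly_eq0_rdvd hF) [G eG].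
have [_ nuX _] := @mpolyX_irreducible K 3 i2.
case: (irr _ _ eG) => [uG|]; last by apply/negP.
have hGX : G * 'X_i2 \is n.-homog by rewrite -eG.
have GX0 : G * 'X_i2 != 0 by rewrite -eG.
have [i [li hG hX]] := homog_factor GX0 hGX.
have i0' := homog_unit_degree hG uG; rewrite i0' subn0 in hX.
have X0 : 'X_i2 != 0 :> {mpoly K[3]} by case: (@mpolyX_irreducible K 3 i2).
have h1 : ('X_i2 : {mpoly K[3]}) \is 1.-homog by rewrite dhomogX; apply/eqP; exact: mdeg1.
by have := dhomog_uniq X0 hX h1 => n1; rewrite n1 in n2.
Qed.

Lemma invariant_curve_degree n : (2 <= n)%N -> has_inv_irr_curve (inSL3q (K:=K) q) n ->
  (q ^ 3 - q ^ 2 <= n)%N /\ ((q ^ 3 - q ^ 2 < n)%N -> (q ^ 3 - q <= n)%N).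
Proof.
move=> n2 [F [[F0 hF] /irreducible_mpolyE irrF inv]].
apply: (SLinvariant_degree_geq _ hF); first exact: ltnW.
  exact: G_invariant_SLinvariant.
exact: line_poly_irreducible hF irrF.
Qed.

Lemma invariant_curve_unique F : F \is (q ^ 3 - q ^ 2).-homog -> irreducible_elt F ->
  SLinvariant p h F -> exists2 c, c != 0 & F = c *: C32.
Proof.
move=> hF [F0 _ _] invF.
have hC := dickson32_form_homog K p_pr h_gt0.
pose c := ev0 0 1 0 F / ev0 0 1 0 C32.
have eF : F = c *: C32.
  apply/eqP; rewrite -subr_eq0; apply/negPn/negP => W0.
  have invC : SLinvariant p h C32.
    by apply: (act_SLinvariant p_pr h_gt0) => M; apply: (SL3q_act_dickson32 p_pr h_gt0 pcharK).
  have /negP[] : ev0 0 1 0 (F - c *: C32) != 0.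
    apply: (SLinvariant_nonvanishing p_pr h_gt0 pcharK W0).
      by rewrite rpredB // rpredZ.
    by move=> i j a ij aq; rewrite rmorphB /= actZ invF // invC.
  by rewrite rmorphB /= [ev0 _ _ _ (_ *: _)]evZ /c /= divfK ?subrr // ev0_dickson32.
by exists c => //; apply: contraNneq F0 => c0; rewrite eF c0 scale0r.
Qed.

Lemma dickson32_curve : has_inv_irr_curve (inSL3q (K:=K) q) (q ^ 3 - q ^ 2).
Proof.
have irr := dickson32_irreducible; exists C32; split.
- by split; [case: irr | apply: dickson32_form_homog].
- exact/irreducible_mpolyE.
- by apply: act_G_invariant => M; apply: SL3q_act_dickson32.
Qed.

Lemma dickson31_curve : has_inv_irr_curve (inSL3q (K:=K) q) (q ^ 3 - q).
Proof.
have irr := dickson31_irreducible; exists C31; split.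
- by split; [case: irr | apply: dickson31_form_homog].
- exact/irreducible_mpolyE.
- by apply: act_G_invariant => M; apply: SL3q_act_dickson31.
Qed.

End Curves.

Theorem mainTheorem9 (K : closedFieldType) (p h : nat) :
  prime p -> (0 < h)%N -> p \in [pchar K] ->
  algebraic_over_Fq K (p ^ h) ->
  let q := (p ^ h)%N in
  let G := inSL3q (K:=K) q in
  [/\ is_dG G (q ^ 3 - q ^ 2)%N,
      is_epsG G (q ^ 2 - q)%N &
      forall F : {mpoly K[3]},
        plane_curve (q ^ 3 - q ^ 2)%N F -> irreducible_mpoly F ->
        G_invariant G F -> is_DGZ_curve q F].
Proof.
move=> p_pr h_gt0 pcharK _ q G.
have q1 : (1 < q)%N := q_gt1 p_pr h_gt0.
have qq : (q < q ^ 2)%N by rewrite -{1}[q]expn1 ltn_exp2l.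
have d2 : (2 <= q ^ 3 - q ^ 2)%N.
  have qm : (0 < q.-1)%N by rewrite -ltnS prednK // ltnW.
  by rewrite cubeB_square (leq_trans q1) // (leq_trans (ltnW qq)) // leq_pmulr.
have dG : is_dG G (q ^ 3 - q ^ 2)%N.
  split=> //; split; first exact: dickson32_curve.
  by move=> m m2 /(invariant_curve_degree p_pr h_gt0 pcharK m2)[].
have e : (q ^ 3 - q ^ 2 + (q ^ 2 - q) = q ^ 3 - q)%N.
  by rewrite addnBA ?(ltnW qq) // subnK // leq_exp2l.
split=> //.
- exists (q ^ 3 - q ^ 2)%N; split=> //; rewrite e; split.
  + by rewrite subn_gt0.
  + exact: dickson31_curve.
  + move=> m lt /(invariant_curve_degree p_pr h_gt0 pcharK (leq_trans d2 (ltnW lt)))[_].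
    by apply.
- move=> F [_ hF] /irreducible_mpolyE irrF inv.
  have [c c0 ->] := invariant_curve_unique p_pr h_gt0 pcharK hF irrF
    (G_invariant_SLinvariant p_pr h_gt0 pcharK irrF inv).
  exact: dickson32_is_DGZ.
Qed.
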